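(* No $2$-step nilmanifold admits a left-invariant generalized Kähler structure. In particular, no $6$-dimensional nilmanifold other than the torus admits a left-invariant generalized Kähler structure.
   Context: A nilmanifold is a quotient $\Gamma\backslash G$ of a connected, simply-connected nilpotent real Lie group $G$ by a maximal lattice (discrete cocompact subgroup); it is $2$-step if its Lie algebra $\mathfrak{g}$ has nilpotency index exactly $2$, i.e. $[\mathfrak{g},\mathfrak{g}]\ne0$ and $[[\mathfrak{g},\mathfrak{g}],\mathfrak{g}]=0$. A structure on $\Gamma\backslash G$ is left-invariant if it descends from a left-invariant structure on $G$. A generalized complex structure on a manifold $M$ is an endomorphism $\mathcal{J}$ of $TM\oplus T^*M$, orthogonal for $\langle X+\xi,Y+\eta\rangle=\frac12(\xi(Y)+\eta(X))$, with $\mathcal{J}^2=-\mathrm{Id}$ and $+i$-eigenbundle closed under the (untwisted) Courant bracket $[X+\xi,Y+\eta]=[X,Y]+X\lfloor d\eta-Y\lfloor d\xi+\frac12d(X\lfloor\eta-Y\lfloor\xi)$. A generalized Kähler structure on $M$ is a pair of commuting generalized complex structures $\mathcal{J}_1,\mathcal{J}_2$ such that $\langle\mathcal{J}_1\mathcal{J}_2\cdot,\cdot\rangle$ is a positive definite metric on $TM\oplus T^*M$. *)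

(* Defs.v *)
From HB Require Import structures.
From mathcomp Require Import all_boot all_order all_algebra.
From mathcomp Require Import all_classical all_reals all_analysis.

Set Implicit Arguments.
Unset Strict Implicit.
Unset Printing Implicit Defensive.

Import Order.TTheory GRing.Theory Num.Theory.
Import numFieldNormedType.Exports.

Local Open Scope classical_set_scope.
Local Open Scope ring_scope.
Local Open Scope quotient_scope.

Section Smoothness.
Context {R : realType} {V W : normedModType R}.

(* Only used for open [U] and finite-dimensional [V] and [W], where it is the
   usual class C^k: the map is differentiable and its directional derivatives
   are of class C^(k-1). *)
Fixpoint Ck (k : nat) (U : set V) (f : V -> W) : Prop :=
  match k with
  | 0 => forall x, U x -> {for x, continuous f}
  | k'.+1 => (forall x, U x -> differentiable f x) /\
             forall v, Ck k' U (fun x => 'D_v f x)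
  end.

Definition smooth_on (U : set V) (f : V -> W) : Prop := forall k, Ck k U f.

End Smoothness.

(* [cinv] is meaningful on [cmap @` cdom] only. *)
Record chart (R : realType) (n : nat) (M : topologicalType) := Chart {
  cdom : set M;
  cmap : M -> 'rV[R]_n;
  cinv : 'rV[R]_n -> M;
  cdom_open : open cdom;
  cimg_open : open (cmap @` cdom);
  cmapK : forall p, cdom p -> cinv (cmap p) = p;
  cmap_continuous : {within cdom, continuous cmap};
  cinv_continuous : {within cmap @` cdom, continuous cinv}
}.

Definition cimg (R : realType) (n : nat) (M : topologicalType)
  (c : chart R n M) : set 'rV[R]_n := cmap c @` cdom c.

Section Maps.
Context {R : realType} {n : nat} {M N : topologicalType}.
Implicit Types (f : M -> N) (a : chart R n M) (b : chart R n N).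

Definition local_rep f a b : 'rV[R]_n -> 'rV[R]_n := cmap b \o f \o cinv a.

Definition local_dom (D : set M) f a b : set 'rV[R]_n :=
  cmap a @` [set p | [/\ cdom a p, D p & cdom b (f p)]].

Definition smooth_map_on (D : set M) (A : set (chart R n M))
    (B : set (chart R n N)) f : Prop :=
  {within D, continuous f} /\
  forall a b, A a -> B b -> smooth_on (local_dom D f a b) (local_rep f a b).

End Maps.

Definition is_atlas (R : realType) (n : nat) (M : topologicalType)
    (A : set (chart R n M)) : Prop :=
  (forall p, exists2 a, A a & cdom a p) /\ smooth_map_on setT A A id.

Definition is_manifold (R : realType) (n : nat) (M : topologicalType)
    (A : set (chart R n M)) : Prop :=
  [/\ hausdorff_space M, @second_countable M & is_atlas A].

Definition local_diffeo (R : realType) (n : nat) (M N : topologicalType)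
    (A : set (chart R n M)) (B : set (chart R n N)) (f : M -> N) : Prop :=
  smooth_map_on setT A B f /\
  forall p, exists U : set M, [/\ open U, U p, open (f @` U) &
    exists g : N -> M, (forall q, U q -> g (f q) = q) /\
                       smooth_map_on (f @` U) B A g].

(* A vector field is given by its components in every chart [a] of the atlas,
   as a function on [cimg a]; invariance under change of charts is
   [vf_related id]. *)
Definition vfield (R : realType) (n : nat) (M : topologicalType) : Type :=
  chart R n M -> 'rV[R]_n -> 'rV[R]_n.

Definition vf_related (R : realType) (n : nat) (M N : topologicalType)
    (A : set (chart R n M)) (B : set (chart R n N)) (f : M -> N)
    (X : vfield R n M) (Y : vfield R n N) : Prop :=
  forall a b, A a -> B b -> forall x, local_dom setT f a b x ->
    Y b (local_rep f a b x) = 'D_(X a x) (local_rep f a b) x.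

Section VectorFields.
Context {R : realType} {n : nat} {M : topologicalType}.
Implicit Types (A : set (chart R n M)) (X Y : vfield R n M).

Definition is_vfield A X : Prop :=
  (forall a, A a -> smooth_on (cimg a) (X a)) /\ vf_related A A id X X.

Definition vf_zero A X : Prop :=
  forall a, A a -> forall x, cimg a x -> X a x = 0.

Definition lie_bracket X Y : vfield R n M :=
  fun a x => 'D_(X a x) (Y a) x - 'D_(Y a x) (X a) x.

End VectorFields.

(* Coordinates [(X, xi)] of an element X + xi of TM (+) T*M. *)
Notation gvec R n := ('rV[R]_n * 'rV[R]_n)%type.

Section GeneralizedTangent.
Context {R : realType} {n : nat}.
Local Notation gvec := (gvec R n).

Definition pairing (xi v : 'rV[R]_n) : R := \sum_(i < n) xi ord0 i * v ord0 i.

Definition ginner (u v : gvec) : R :=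
  2^-1 * (pairing u.2 v.1 + pairing v.2 u.1).

Definition ebase (j : 'I_n) : 'rV[R]_n := delta_mx ord0 j.

(* d eta (u, v) = u (eta (v)) - v (eta (u)) for constant u and v, without the
   factor 1/2 of some texts. *)
Definition ext_d (eta : 'rV[R]_n -> 'rV[R]_n) (x u v : 'rV[R]_n) : R :=
  pairing ('D_u eta x) v - pairing ('D_v eta x) u.

Definition contract_d (v : 'rV[R]_n) (eta : 'rV[R]_n -> 'rV[R]_n)
    (x : 'rV[R]_n) : 'rV[R]_n := \row_j ext_d eta x v (ebase j).

Definition dfun (h : 'rV[R]_n -> R) (x : 'rV[R]_n) : 'rV[R]_n :=
  \row_j 'D_(ebase j) h x.

Definition courant (s t : 'rV[R]_n -> gvec) (x : 'rV[R]_n) : gvec :=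
  let X y := (s y).1 in let xi y := (s y).2 in
  let Y y := (t y).1 in let eta y := (t y).2 in
  ('D_(X x) Y x - 'D_(Y x) X x,
   contract_d (X x) eta x - contract_d (Y x) xi x
   + 2^-1 *: dfun (fun y => pairing (eta y) (X y) - pairing (xi y) (Y y)) x).

(* The pair [(s, t)] stands for the complex section s + i t; this is the
   complex bilinear extension of the Courant bracket. *)
Definition ccourant (z w : 'rV[R]_n -> gvec * gvec) (x : 'rV[R]_n) :
    gvec * gvec :=
  let s y := (z y).1 in let t y := (z y).2 in
  let s' y := (w y).1 in let t' y := (w y).2 in
  (courant s s' x - courant t t' x, courant s t' x + courant t s' x).

(* J (s + i t) = i (s + i t) *)
Definition plus_i_eigen (J : gvec -> gvec) (z : gvec * gvec) : Prop :=
  J z.1 = - z.2 /\ J z.2 = z.1.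

End GeneralizedTangent.

(* A field of endomorphisms of TM (+) T*M, in coordinates in every chart. *)
Definition gendo (R : realType) (n : nat) (M : topologicalType) : Type :=
  chart R n M -> 'rV[R]_n -> gvec R n -> gvec R n.

Section Related.
Context {R : realType} {n : nat} {M N : topologicalType}.

(* [gpush F x] is the graph of the isomorphism of generalized tangent spaces
   X + xi |-> dF(X) + (dF^-1)^* xi induced by a local diffeomorphism [F]. *)
Definition gpush (F : 'rV[R]_n -> 'rV[R]_n) (x : 'rV[R]_n)
    (u v : gvec R n) : Prop :=
  v.1 = 'D_(u.1) F x /\ forall w, pairing u.2 w = pairing v.2 ('D_w F x).

Definition gendo_related (A : set (chart R n M)) (B : set (chart R n N))
    (f : M -> N) (J : gendo R n M) (K : gendo R n N) : Prop :=
  forall a b, A a -> B b -> forall x, local_dom setT f a b x ->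
  forall u v, gpush (local_rep f a b) x u v ->
    gpush (local_rep f a b) x (J a x u) (K b (local_rep f a b x) v).

End Related.

Section GeneralizedKahler.
Context {R : realType} {n : nat} {M : topologicalType}.
Variable A : set (chart R n M).
Implicit Types J : gendo R n M.

Record is_gendo J : Prop := {
  gendo_linear : forall a, A a -> forall x, cimg a x -> linear (J a x);
  gendo_smooth : forall a, A a -> forall u,
    smooth_on (cimg a) (fun x => J a x u);
  gendo_compat : gendo_related A A id J J
}.

Record generalized_complex J : Prop := {
  gc_endo : is_gendo J;
  gc_orthogonal : forall a, A a -> forall x, cimg a x -> forall u v,
    ginner (J a x u) (J a x v) = ginner u v;
  gc_square : forall a, A a -> forall x, cimg a x -> forall u,
    J a x (J a x u) = - u;
  gc_integrable : forall a, A a ->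
    forall U : set 'rV[R]_n, open U -> U `<=` cimg a ->
    forall z w : 'rV[R]_n -> gvec R n * gvec R n,
    smooth_on U z -> smooth_on U w ->
    (forall x, U x -> plus_i_eigen (J a x) (z x)) ->
    (forall x, U x -> plus_i_eigen (J a x) (w x)) ->
    forall x, U x -> plus_i_eigen (J a x) (ccourant z w x)
}.

Record generalized_kahler (J1 J2 : gendo R n M) : Prop := {
  gk_gc1 : generalized_complex J1;
  gk_gc2 : generalized_complex J2;
  gk_commute : forall a, A a -> forall x, cimg a x -> forall u,
    J1 a x (J2 a x u) = J2 a x (J1 a x u);
  gk_positive : forall a, A a -> forall x, cimg a x -> forall u,
    u != 0 -> 0 < ginner (J1 a x (J2 a x u)) u
}.

End GeneralizedKahler.

(* No compatibility between the group law and the topology is assumed here;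
   see [lie_group]. *)
#[short(type="topGroupType")]
HB.structure Definition TopGroup := {G of Group G & Topological G}.

Definition ltrans (G : topGroupType) (g : G) : G -> G := fun x => (g * x)%g.

Section LieGroups.
Context {R : realType} {n : nat} {G : topGroupType}.
Variable A : set (chart R n G).

Definition smooth_mul : Prop :=
  continuous (fun p : G * G => (p.1 * p.2)%g) /\
  forall a b c, A a -> A b -> A c ->
    smooth_on
      [set xy : 'rV[R]_n * 'rV[R]_n | exists p q : G,
         [/\ cdom a p, cdom b q, cdom c (p * q)%g & xy = (cmap a p, cmap b q)]]
      (fun xy => cmap c (cinv a xy.1 * cinv b xy.2)%g).

Definition lie_group : Prop :=
  [/\ is_manifold A, smooth_mul & smooth_map_on setT A A (fun x : G => x^-1%g)].

Definition left_invariant_vf (X : vfield R n G) : Prop :=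
  is_vfield A X /\ forall g : G, vf_related A A (ltrans g) X X.

Definition left_invariant_gendo (J : gendo R n G) : Prop :=
  forall g : G, gendo_related A A (ltrans g) J J.

(* The fields [..[[X0, X1], X2].., Xk] with X0, .., Xk in the Lie algebra of G;
   they span the term of index k of its lower central series, starting with
   the Lie algebra itself for k = 0. *)
Fixpoint iterated_bracket (k : nat) (Z : vfield R n G) : Prop :=
  match k with
  | 0 => left_invariant_vf Z
  | k'.+1 => exists X Y, [/\ iterated_bracket k' X, left_invariant_vf Y &
                             Z = lie_bracket X Y]
  end.

Definition lcs_trivial (k : nat) : Prop :=
  forall Z, iterated_bracket k Z -> vf_zero A Z.

Definition nilpotent_lie : Prop := exists k, lcs_trivial k.

Definition two_step_lie : Prop := ~ lcs_trivial 1 /\ lcs_trivial 2.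

End LieGroups.

(* Every loop is homotopic to a constant one, relatively to its endpoints. *)
Definition simply_connected (R : realType) (T : topologicalType) : Prop :=
  connected [set: T] /\
  forall gamma : R -> T, {within `[0, 1], continuous gamma} ->
    gamma 0 = gamma 1 ->
  exists H : R * R -> T,
    [/\ {within [set st | 0 <= st.1 <= 1 /\ 0 <= st.2 <= 1], continuous H},
        (forall t, 0 <= t <= 1 -> H (t, 0) = gamma t),
        (forall t, 0 <= t <= 1 -> H (t, 1) = gamma 0) &
        (forall s, 0 <= s <= 1 -> H (0, s) = gamma 0 /\ H (1, s) = gamma 0)].

Record subgroup (G : topGroupType) := Subgroup {
  sub_set :> set G;
  sub_1 : sub_set 1%g;
  sub_M : forall x y, sub_set x -> sub_set y -> sub_set (x * y)%g;
  sub_V : forall x, sub_set x -> sub_set x^-1%g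
}.

Section Quotient.
Variables (G : topGroupType) (Gamma : subgroup G).

(* The coset equality Gamma x = Gamma y. *)
Definition same_coset (x y : G) : bool := `[< sub_set Gamma (x * y^-1)%g >].

Lemma same_coset_equiv : equiv_class_of same_coset.
Proof.
split=> [x|x y|y x z]; rewrite /same_coset.
- by apply/asboolP; rewrite mulgV; exact: sub_1.
- by apply/asbool_equiv_eq; split=> /sub_V; rewrite invgM invgK.
- move=> /asboolP xy /asboolP yz; apply/asboolP.
  by have := sub_M xy yz; rewrite mulgA mulgVK.
Qed.

Canonical same_coset_rel := EquivRelPack same_coset_equiv.

(* The space Gamma \ G of cosets Gamma x, with the quotient topology. *)
Definition coset_space : topologicalType :=
  quotient_topology {eq_quot same_coset_rel}.

Definition coset_proj : G -> coset_space :=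
  \pi_(quotient_topology {eq_quot same_coset_rel}).

Definition is_lattice : Prop :=
  (forall g, sub_set Gamma g -> exists2 U : set G, open U & U `&` Gamma = [set g]) /\
  compact [set: coset_space].

End Quotient.

(* The smooth structure of Gamma \ G is the one for which the projection is a
   local diffeomorphism. *)
Record nilmanifold (R : realType) (n : nat) := Nilmanifold {
  nil_group : topGroupType;
  nil_gatlas : set (chart R n nil_group);
  nil_lattice : subgroup nil_group;
  nil_atlas : set (chart R n (coset_space nil_lattice));
  nil_lie : lie_group nil_gatlas;
  nil_simply_connected : simply_connected R nil_group;
  nil_nilpotent : nilpotent_lie nil_gatlas;
  nil_is_lattice : is_lattice nil_lattice;
  nil_manifold : is_manifold nil_atlas;
  nil_proj : local_diffeo nil_gatlas nil_atlas (coset_proj nil_lattice)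
}.

Arguments nil_gatlas {R n} _ _.
Arguments nil_atlas {R n} _ _.

Section Nilmanifolds.
Context {R : realType} {n : nat}.
Variable N : nilmanifold R n.

Definition two_step : Prop := two_step_lie (nil_gatlas N).

(* Among the nilmanifolds Gamma \ G, the tori are those with G abelian: G is
   then isomorphic to R^n, since it is connected and simply connected. *)
Definition is_torus : Prop :=
  forall x y : nil_group N, (x * y)%g = (y * x)%g.

Definition admits_left_invariant_gk : Prop :=
  exists J1 J2 : gendo R n (coset_space (nil_lattice N)),
    generalized_kahler (nil_atlas N) J1 J2 /\
    exists K1 K2 : gendo R n (nil_group N),
      [/\ generalized_kahler (nil_gatlas N) K1 K2,
          left_invariant_gendo (nil_gatlas N) K1 /\
          left_invariant_gendo (nil_gatlas N) K2,
          gendo_related (nil_gatlas N) (nil_atlas N)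
            (coset_proj (nil_lattice N)) K1 J1 &
          gendo_related (nil_gatlas N) (nil_atlas N)
            (coset_proj (nil_lattice N)) K2 J2].

End Nilmanifolds.

(* Main.v *)
Require Import Defs.
From HB Require Import structures.
From mathcomp Require Import all_boot all_order all_algebra.
From mathcomp Require Import all_classical all_reals all_analysis.
From mathcomp Require Import ring lra.

(** The generalized Kähler structure is used only through its value on the
    Lie algebra g of the group. Left-invariant sections of the generalized
    tangent bundle form, under the Courant bracket, the Lie algebra D = g (+) g* of [courant_alg]: the natural
    pairing <,> is ad-invariant on D, and D is nilpotent because g is. The
    structure becomes a pair of commuting orthogonal complex structures J1, J2
    on D whose +i eigenspaces are subalgebras, with <J1 J2 x, x> > 0 for x <> 0.
    Such a D is abelian whatever its nilpotency step
    ([nilpotent_quadratic_kahler_abelian]); hence so is g.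

    The algebra runs as follows. Let G = J1 J2, an involution, let V+ and V- be
    its +1 and -1 eigenspaces, on which <,> is positive definite and negative
    definite respectively, and let J = J1. Since J2 is -J on V+ and J on V-, integrability of both
    structures gives <[x, y], z> = <[Jx, Jy], z> when x, y lie in one eigenspace
    and z in the other. So bracketing with x in V+ and projecting to V- is an
    operator s(x) of V- that commutes with J, and is skew since <,> is
    invariant. The bracket {x, y} = [x, y] - [Jx, Jy] is J-bilinear and
    nilpotent: it is the bracket of the +i eigenspace of J seen through
    x |-> x - iJx. Therefore all products of many operators
    S(x) = s(x) - J s(Jx) vanish, and so do the traces over V+ of the operators
    {x, .}. The latter says that the sum of [e_j, J e_j] over an orthonormal
    basis of V+ is zero; bracketing that identity with v in V- and pairing it
    with Jv yields
      sum_j |S(e_j) v|^2 = sum_j |S(e_j)^T v|^2.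
    A vector killed by all S(x) is thus killed by all S(x)^T, so it is
    orthogonal to every image of S(x). Applied to the value of a longest nonzero
    product of operators S(x), this forces S = 0, hence s = 0
    ([mixed_bracket_neg]). By symmetry [V+, V-] = 0; then <G x, y> is an
    ad-invariant inner product, and nilpotency kills the bracket.

    The passage from the group to the algebra is in coordinates. A vector u at
    the identity extends to a left-invariant field [lfield u]; naturality of the
    bracket of vector fields ([vbracket_related], which rests on the symmetry of
    second derivatives) gives [lfield u, lfield v] = lfield [u, v], the Jacobi
    identity and the nilpotency of the bracket of g ([brk]). A left-invariant
    structure has constant coefficients in the frame [linv_section], where its
    integrability is the algebraic condition above ([gc_integrable_alg]).

    If g is abelian then the group is not two-step ([lcs_trivial1]), which is the
    first claim. For the second one, the group must be shown to be commutative
    ([connected_commutative]). Left-invariant fields commute with right-invariant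
    ones, so when they also commute with each other the coefficients of a
    right-invariant field in the left-invariant frame are constant, and the two
    kinds of fields coincide near 1. Differentiating
    (y h y^-1) y = y h then shows that y |-> y h y^-1 is locally constant, so
    elements close to 1 commute, and they generate the connected group. *)

Set Implicit Arguments.
Unset Strict Implicit.
Unset Printing Implicit Defensive.
Import Order.TTheory GRing.Theory Num.Theory.
Import numFieldNormedType.Exports.
Local Open Scope ring_scope.

(** * Nilpotent quadratic Lie algebras with a pair of complex structures *)

Section LinearFunctions.
Variables (R : pzRingType).

Lemma lin0 (V W : lmodType R) (f : V -> W) : linear f -> f 0 = 0.
Proof.
by move=> fL; have := fL (-1) 0 0; rewrite scaler0 addr0 scaleN1r addNr.
Qed.

Lemma linD (V W : lmodType R) (f : V -> W) : linear f -> {morph f : x y / x + y}.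
Proof. by move=> fL x y; rewrite -[x in LHS]scale1r fL scale1r. Qed.

Lemma linZ (V W : lmodType R) (f : V -> W) :
  linear f -> forall a, {morph f : x / a *: x}.
Proof. by move=> fL a x; rewrite -[a *: x]addr0 fL lin0 // addr0. Qed.

Lemma linN (V W : lmodType R) (f : V -> W) : linear f -> {morph f : x / - x}.
Proof.
by move=> fL x; have := fL (-1) x 0; rewrite !addr0 lin0 // addr0 !scaleN1r.
Qed.

Lemma linB (V W : lmodType R) (f : V -> W) : linear f -> {morph f : x y / x - y}.
Proof. by move=> fL x y; rewrite linD // linN. Qed.

Lemma lin_sum (V W : lmodType R) (f : V -> W) I (r : seq I) (F : I -> V) :
  linear f -> f (\sum_(i <- r) F i) = \sum_(i <- r) f (F i).
Proof. by move=> fL; apply: big_morph; [exact: linD|exact: lin0]. Qed.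

End LinearFunctions.

(** Induction on the exponent: a full-rank factorization A = CB gives
    tr A = tr (BC), and (BC)^k = 0 follows from A^(k+1) = C (BC)^k B. *)
Lemma mxtrace_nilpotent (F : fieldType) (k n : nat) (A : 'M[F]_n) :
  iter k (mulmx A) 1%:M = 0 -> \tr A = 0.
Proof.
elim: k n A => [|k IHk] n A Ak.
  have := mulmx1 A; rewrite -[1%:M]/(iter 0 (mulmx A) 1%:M) Ak mulmx0 => <-.
  exact: mxtrace0.
rewrite -(mulmx_base A) mxtrace_mulC; apply: IHk.
have E j : iter j.+1 (mulmx A) 1%:M = col_base A *m
   iter j (mulmx (row_base A *m col_base A)) 1%:M *m row_base A.
  elim: j => [|j IHj]; first by rewrite /= mulmx1 mulmx1 mulmx_base.
  rewrite [LHS]iterS IHj [X in _ = _ *m X *m _]iterS.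
  by rewrite -[X in X *m (_ *m _ *m _) = _](mulmx_base A) !mulmxA.
move: Ak; rewrite E => {E}.
have [L] := row_fullP (col_base_full A).
have [L'] := row_freeP (row_base_free A).
move: (col_base A) (row_base A) => C B BL LC H.
have := congr1 (fun M => L *m M *m L') H.
by rewrite !mulmxA LC mul1mx -mulmxA BL mulmx1 mulmx0 mul0mx.
Qed.

Section Orthonormal.
Variables (R : rcfType) (D : lmodType R) (E : D -> D -> R).
Hypothesis EL : forall z, scalar (E^~ z).
Hypothesis Esym : forall x y, E x y = E y x.
Hypothesis Epos : forall x, x != 0 -> 0 < E x x.

Let ElinL a x y z : E (a *: x + y) z = a * E x z + E y z. Proof. exact: EL. Qed.

Let E0l z : E 0 z = 0.
Proof. by have := ElinL (-1) 0 0 z; rewrite scaler0 addr0 mulN1r addNr. Qed.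

Let ED x y z : E (x + y) z = E x z + E y z.
Proof. by rewrite -[x]scale1r ElinL mul1r scale1r. Qed.

Let EZ a x z : E (a *: x) z = a * E x z.
Proof. by rewrite -[a *: x]addr0 ElinL E0l addr0. Qed.

Let Esum I (r : seq I) (f : I -> D) z : E (\sum_(i <- r) f i) z = \sum_(i <- r) E (f i) z.
Proof.
elim: r => [|i r IH]; first by rewrite !big_nil E0l.
by rewrite !big_cons ED IH.
Qed.

(** Gram-Schmidt. The result is a family in which every vector of [bs] is
    expanded, so that no notion of dimension is involved. *)
Lemma orthonormal_family (bs : seq D) :
  exists os : seq D, [/\ uniq os,
     {in os &, forall x y, E x y = (x == y)%:R} &
     {in bs, forall b, b = \sum_(o <- os) E b o *: o}].
Proof.
elim: bs => [|b bs [os [uos oos sos]]]; first by exists [::]; split.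
pose b' := b - \sum_(o <- os) E b o *: o.
have b'E o : o \in os -> E b' o = 0.
  move=> oin; rewrite /b' -scaleN1r addrC ElinL mulN1r Esum.
  rewrite (bigD1_seq o) //= EZ (oos o o) // eqxx mulr1 big_seq_cond big1 ?addr0 ?addNr //; last first.
  by move=> i /andP[iin /negPf ine]; rewrite EZ (oos i o) // ine mulr0.
have [b'0|b'n0] := eqVneq b' 0.
  exists os; split=> // x; rewrite inE => /predU1P[->|]; last exact: sos.
  by apply/eqP; rewrite -subr_eq0; apply/eqP.
pose r := Num.sqrt (E b' b').
have r0 : r != 0 by rewrite sqrtr_eq0 -ltNge; exact: Epos.
have rr : r * r = E b' b' by rewrite -expr2 sqr_sqrtr // ltW // Epos.
pose o' := r^-1 *: b'.
have o'o o : o \in os -> E o' o = 0 by move=> /b'E H; rewrite /o' EZ H mulr0.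
have o'1 : E o' o' = 1.
  rewrite /o' EZ Esym EZ -rr [r^-1 * (r * r)]mulKf ?mulVf//.
have o'n : o' \notin os.
  by apply/negP => /o'o; rewrite o'1 => /eqP; rewrite oner_eq0.
exists (o' :: os); split; first by rewrite /= o'n.
  move=> x y; rewrite !inE => /predU1P[->|xin] /predU1P[->|yin].
  - by rewrite eqxx.
  - rewrite o'o //; case: eqP => // xy; by rewrite xy yin in o'n.
  - rewrite Esym o'o //; case: eqP => // xy; by rewrite -xy xin in o'n.
  - exact: oos.
move=> x; rewrite inE => /predU1P[->|xin].
  rewrite big_cons.
  have -> : E b o' = r.
    have -> : b = b' + \sum_(o <- os) E b o *: o by rewrite /b' subrK.
    rewrite ED [E (bigop.body _ _ _) _]Esum big_seq big1 ?addr0; last first.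
      by move=> i iin; rewrite EZ [E i _]Esym o'o // mulr0.
    by rewrite Esym /o' EZ -rr mulKf.
  by rewrite /o' scalerA mulfV // scale1r /b' subrK.
rewrite big_cons {1}(sos x xin) (_ : E x o' = 0) ?scale0r ?add0r //.
rewrite (sos x xin) Esum big_seq big1 // => o oin.
by rewrite EZ [E o _]Esym o'o // mulr0.
Qed.

End Orthonormal.

Section MixedBracket.
Variables (R : realFieldType) (D : lmodType R).
Variables (br : D -> D -> D) (B : D -> D -> R) (J G : {linear D -> D}).

(** The inner product <G x, y>, positive definite although <,> has neutral
    signature. *)
Definition eform x y := B (G x) y.
Definition proj_pos x := 2^-1 *: (x + G x).
Definition proj_neg x := 2^-1 *: (x - G x).
(** The bracket of the +i eigenspace of J, carried to the real Lie algebra by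
    x |-> x - i J x. *)
Definition jbr x y := br x y - br (J x) (J y).

Hypothesis brL : forall z, linear (br^~ z).
Hypothesis brA : forall x y, br x y = - br y x.
Hypothesis brJac : forall x y z, br x (br y z) = br (br x y) z + br y (br x z).
Variable K : nat.
Hypothesis brnil : forall s x, size s = K -> foldr br x s = 0.
Hypothesis BL : forall z, scalar (B^~ z).
Hypothesis Bsym : forall x y, B x y = B y x.
Hypothesis Binv : forall x y z, B (br x y) z = B x (br y z).
Hypothesis JJ : forall x, J (J x) = - x.
Hypothesis BJ : forall x y, B (J x) y = - B x (J y).
Hypothesis Jint : forall x y, J (jbr x y) = br x (J y) + br (J x) y.
Hypothesis GG : forall x, G (G x) = x.
Hypothesis GJ : forall x, G (J x) = J (G x).
Hypothesis BG : forall x y, B (G x) y = B x (G y).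
Hypothesis Epos : forall x, x != 0 -> 0 < eform x x.
(* Consequences of the integrability of both complex structures: J, and the one
   equal to - J on V+ and to J on V-. *)
Hypothesis Tpos : forall x y z, G x = x -> G y = y -> G z = - z ->
  B (br x y) z = B (br (J x) (J y)) z.
Hypothesis Tneg : forall x y z, G x = - x -> G y = - y -> G z = z ->
  B (br x y) z = B (br (J x) (J y)) z.
Variables (m : nat) (e : 'I_m -> D).
Hypothesis e_on : forall i j, eform (e i) (e j) = (i == j)%:R.
Hypothesis e_span : forall x, x = \sum_i eform x (e i) *: e i.

Local Notation E := eform.
Local Notation P := proj_pos.
Local Notation Q := proj_neg.

Lemma brLr z : linear (br z).
Proof. by move=> a x y; rewrite brA brL opprD -scalerN -!(brA z). Qed.

Let brDl x y z : br (x + y) z = br x z + br y z. Proof. exact: (linD (@brL z)). Qed.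
Let brDr x y z : br z (x + y) = br z x + br z y. Proof. exact: (linD (@brLr z)). Qed.
Let brNl x z : br (- x) z = - br x z. Proof. exact: (linN (@brL z)). Qed.
Let brNr x z : br z (- x) = - br z x. Proof. exact: (linN (@brLr z)). Qed.
Let br0 z : br z 0 = 0. Proof. exact: (lin0 (@brLr z)). Qed.

Let BL' z : linear (fun x => B x z : R^o). Proof. exact: BL. Qed.
Let BDl x y z : B (x + y) z = B x z + B y z. Proof. exact: (linD (@BL' z)). Qed.
Let BDr x y z : B z (x + y) = B z x + B z y. Proof. by rewrite !(Bsym z) BDl. Qed.
Let BNl x z : B (- x) z = - B x z. Proof. exact: (linN (@BL' z)). Qed.
Let BNr x z : B z (- x) = - B z x. Proof. by rewrite !(Bsym z) BNl. Qed.
Let BZl a x z : B (a *: x) z = a * B x z. Proof. exact: (linZ (@BL' z)). Qed.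
Let BZr a x z : B z (a *: x) = a * B z x. Proof. by rewrite !(Bsym z) BZl. Qed.
Let B0l z : B 0 z = 0. Proof. exact: (lin0 (@BL' z)). Qed.
Let B0r z : B z 0 = 0. Proof. by rewrite Bsym B0l. Qed.

Let Esym x y : E x y = E y x. Proof. by rewrite /E BG Bsym. Qed.
Let E0 x : E x x = 0 -> x = 0.
Proof. by move=> Ex; apply: contra_eq Ex => /Epos; rewrite lt0r => /andP[]. Qed.
Let Ege0 x : 0 <= E x x.
Proof.
by have [->|/Epos/ltW//] := eqVneq x 0; rewrite /E linear0 B0l.
Qed.
Let ELl z : linear (fun x => E x z : R^o).
Proof. by move=> a x y; rewrite /E linearP BL'. Qed.

Let br_self y : br y y = 0.
Proof.
have /eqP := brA y y; rewrite -subr_eq0 opprK -mulr2n -(scaler_nat 2).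
by rewrite scaler_eq0 pnatr_eq0 => /eqP.
Qed.

Let half_add (x : D) : 2^-1 *: (x + x) = x.
Proof.
by rewrite -mulr2n -(scaler_nat 2 x) scalerA mulVf ?scale1r // pnatr_eq0.
Qed.

Let GN x : G (- x) = - G x. Proof. exact: linearN. Qed.
Let JN x : J (- x) = - J x. Proof. exact: linearN. Qed.
Let GB x y : G (x - y) = G x - G y. Proof. exact: linearB. Qed.
Let GP x : G (P x) = P x.
Proof. by rewrite /P linearZ linearD /= GG addrC. Qed.
Let GQ x : G (Q x) = - Q x.
Proof. by rewrite /Q linearZ linearB /= GG -scalerN opprB. Qed.
Let PQ x : x = P x + Q x.
Proof. by rewrite /P /Q -scalerDr addrACA subrr addr0 half_add. Qed.
Let PJ x : J (P x) = P (J x).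
Proof. by rewrite /P linearZ linearD /= GJ. Qed.
Let QJ x : J (Q x) = Q (J x).
Proof. by rewrite /Q linearZ linearB /= GJ. Qed.
Let P_id x : G x = x -> P x = x.
Proof. by rewrite /P => ->; rewrite half_add. Qed.
Let Q_id x : G x = - x -> Q x = x.
Proof. by rewrite /Q => ->; rewrite opprK half_add. Qed.
Let fixG x : Q x = 0 -> G x = x.
Proof. by move=> Qx; rewrite [x in LHS]PQ Qx addr0 GP [RHS]PQ Qx addr0. Qed.
Let PL : linear P.
Proof.
move=> a x y; rewrite /P (linearP G) scalerA mulrC -scalerA -scalerDr; congr (_ *: _).
by rewrite scalerDr addrACA.
Qed.
Let QL : linear Q.
Proof.
move=> a x y; rewrite /Q (linearP G) scalerA mulrC -scalerA -scalerDr; congr (_ *: _).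
by rewrite scalerBr opprD addrACA.
Qed.
Let BP x y : B (P x) y = B x (P y).
Proof. by rewrite /P BZl BZr BDl BDr BG. Qed.
Let BQ x y : B (Q x) y = B x (Q y).
Proof. by rewrite /Q BZl BZr BDl BDr BNl BNr BG. Qed.
Let BPQ x y : B x y = B (P x) (P y) + B (Q x) (Q y).
Proof.
rewrite BP BQ (P_id (GP y)) (Q_id (GQ y)) -BDr -PQ //.
Qed.

Let jbrLr x : linear (jbr x).
Proof.
by move=> a y z; rewrite /jbr linearP !brLr scalerBr opprD addrACA.
Qed.

Lemma eform_trace_nilpotent f k : linear f -> (forall x, iter k f x = 0) ->
  \sum_i E (f (e i)) (e i) = 0.
Proof.
move=> fL fk; pose A := \matrix_(i, j) E (f (e j)) (e i).
have -> : \sum_i E (f (e i)) (e i) = \tr A by apply: eq_bigr => i _; rewrite mxE.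
apply: (@mxtrace_nilpotent _ k).
(* Column j of A^l holds the coordinates of f^l (e j). *)
suff H l : iter l (mulmx A) 1%:M = \matrix_(i, j) E (iter l f (e j)) (e i).
  by rewrite H; apply/matrixP => i j; rewrite !mxE fk (lin0 (@ELl _)).
elim: l => [|l IH]; apply/matrixP => i j; first by rewrite !mxE e_on eq_sym.
rewrite iterS IH !mxE iterS [iter l f (e j) in RHS]e_span lin_sum //.
rewrite (lin_sum _ _ (@ELl _)); apply: eq_bigr => k' _.
by rewrite !mxE linZ // (linZ (@ELl _)) mulrC.
Qed.

(** The sum is the trace of the product of the transpose of f with g. *)
Lemma trace_skew_sym f g : linear f -> linear g ->
  (forall x y, E (f x) y = - E x (f y)) ->
  (forall x y, E (g x) y = E x (g y)) -> \sum_i E (f (e i)) (g (e i)) = 0.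
Proof.
move=> fL gL fA gS.
pose t i j := E (f (e i)) (e j) * E (g (e i)) (e j).
have -> : \sum_i E (f (e i)) (g (e i)) = \sum_i \sum_j t i j.
  apply: eq_bigr => i _; rewrite Esym {1}[g (e i)]e_span (lin_sum _ _ (@ELl _)).
  by apply: eq_bigr => j _; rewrite (linZ (@ELl _)) /t mulrC [E (e j) _]Esym.
have tA i j : t j i = - t i j by rewrite /t fA gS ![E (e j) _]Esym mulNr.
(* Exchanging the two summation indices changes the sign of each term. *)
set s := \sum_i _; have : s = - s.
  rewrite {1}/s exchange_big /= -sumrN; apply: eq_bigr => i _.
  by rewrite -sumrN; apply: eq_bigr => j _; rewrite tA.
lra.
Qed.

(** Integrability makes [jbr] linear over J, so J maps an iterated [jbr] to a
    sum of iterated brackets of the same length. Each further bracket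
    moves one step down the upper central series, whose j-th term is [U j]. *)
Lemma jbr_nilpotent s x : size s = K -> foldr jbr x s = 0.
Proof.
pose U j z := forall t, size t = j -> foldr br z t = 0.
suff H t j : (j + size t)%N = K -> U j (foldr jbr x t) /\ U j (J (foldr jbr x t)).
  by move=> sK; have [|H0 _] := H s 0%N; [rewrite add0n|exact: (H0 [::])].
have foldrD y z t' : foldr br (y + z) t' = foldr br y t' + foldr br z t'.
  by elim: t' => //= a t' ->; rewrite brDr.
have foldrN y t' : foldr br (- y) t' = - foldr br y t'.
  by elim: t' => //= a t' ->; rewrite brNr.
have Ubr l a z : U l.+1 z -> U l (br a z).
  move=> Uz t' st'; have := Uz (rcons t' a).
  by rewrite size_rcons st' foldr_rcons; exact.
elim: t j => [|a t IH] j; first by rewrite addn0 => ->; split=> t'; exact: brnil.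
rewrite /= addnS -addSn => /IH[Uz UJz]; split=> t' st'.
  by rewrite foldrD foldrN !(Ubr j _ _ _ t' st') // subrr.
by rewrite Jint foldrD !(Ubr j _ _ _ t' st') // addr0.
Qed.

Let jbr_pos x y : G x = x -> G y = y -> Q (jbr x y) = 0.
Proof.
move=> Gx Gy; apply: E0; rewrite /E GQ BNl BQ (Q_id (GQ _)) {1}/jbr BDl BNl.
by rewrite Tpos ?GQ // subrr oppr0.
Qed.

Let jbr_neg x y : G x = - x -> G y = - y -> P (jbr x y) = 0.
Proof.
move=> Gx Gy; apply: E0; rewrite /E GP BP (P_id (GP _)) {1}/jbr BDl BNl.
by rewrite Tneg ?GP // subrr.
Qed.

(** The operator is nilpotent on V+ also for x in V-: bracketing with x
    maps V- to itself, so powers may be computed before projecting to V+. *)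
Let tr_jbr x : G x = x \/ G x = - x ->
  \sum_i B (jbr x (P (e i))) (P (e i)) = 0.
Proof.
move=> Gx; pose f y := P (jbr x (P y)).
rewrite (eq_bigr (fun i => E (f (e i)) (e i))); last first.
  by move=> i _; rewrite /E /f GP BP.
apply: (@eform_trace_nilpotent f K.+1).
  by move=> a y z; rewrite /f PL jbrLr PL.
move=> y.
have H k : iter k.+1 f y = P (iter k.+1 (jbr x) (P y)) /\
           (G x = x -> G (iter k (jbr x) (P y)) = iter k (jbr x) (P y)).
  elim: k => [|k [IH1 IH2]]; first by rewrite GP.
  split; last first.
    by move=> Gx'; apply: fixG; rewrite iterS jbr_pos ?IH2.
  rewrite iterS IH1 /f (P_id (GP _)) [RHS]/=.
  rewrite -iterS; case: Gx => Gx.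
    by rewrite [P (iter _ _ _)]P_id //; apply: fixG; rewrite iterS jbr_pos ?IH2.
  rewrite [X in _ = P (jbr x X)]PQ (linD (@jbrLr x)) (linD PL).
  by rewrite [P (jbr x (Q _))]jbr_neg ?GQ // addr0.
rewrite (H K).1 iterS.
have -> : iter K (jbr x) (P y) = foldr jbr (P y) (nseq K x).
  by elim: (K) => //= k ->.
by rewrite jbr_nilpotent ?size_nseq // (lin0 (@jbrLr x)) (lin0 PL).
Qed.

Let tr_br x : \sum_i B (br x (J (P (e i)))) (P (e i)) = 0.
Proof.
suff H y : G y = y \/ G y = - y -> \sum_i B (br y (J (P (e i)))) (P (e i)) = 0.
  have := congr2 +%R (H (P x) (or_introl (GP x))) (H (Q x) (or_intror (GQ x))).
  rewrite addr0 -big_split => {}H; rewrite -[RHS]H.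
  by apply: eq_bigr => i _; rewrite {1}[x]PQ brDl BDl.
move=> Gy; rewrite -[RHS](@tr_jbr (J y)); last first.
  by case: Gy => Gy; [left|right]; rewrite GJ Gy // linearN.
apply: eq_bigr => i _.
by rewrite /jbr BDl BNl [B (br (J y) (P _)) _]Binv br_self B0r JJ brNl BNl opprK add0r.
Qed.

(** The Casimir element of J on V+; it pairs with x to the trace of J ad x on
    V+, which is the trace of the nilpotent operator {Jx, .} up to the trace of
    a skew one. *)
Let casimir : \sum_i br (P (e i)) (J (P (e i))) = 0.
Proof.
set k := \sum_i _; apply: E0; rewrite /E; set x := G k.
rewrite Bsym /k (lin_sum _ _ (@BL' _)).
transitivity (- \sum_i B (br x (J (P (e i)))) (P (e i))); last first.
  by rewrite tr_br oppr0.
rewrite -sumrN.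
by apply: eq_bigr => i _; rewrite [in RHS]Binv [in RHS]brA BNr opprK Bsym.
Qed.

Let comm_neg a v : G a = a -> G v = - v -> Q (br a (J v)) = J (Q (br a v)).
Proof.
move=> Ga Gv; apply/eqP; rewrite -subr_eq0; apply/eqP.
rewrite QJ -(linB QL); apply: E0; set w := Q _.
have Gw : G w = - w by rewrite GQ.
rewrite /E Gw BNl /w BQ (Q_id (GQ _)) -/w BDl BNl BJ opprK.
have -> : B (br a (J v)) w = B (br (J v) w) a by rewrite Bsym -Binv brA BNl Binv -BNr -brA Bsym.
rewrite Tneg ?GJ ?Gv ?linearN //= JJ brNl BNl.
by rewrite [B (br a v) _]Binv Bsym addNr oppr0.
Qed.

Let comm_pos a v : G a = a -> G v = - v -> P (br v (J a)) = J (P (br v a)).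
Proof.
move=> Ga Gv; apply/eqP; rewrite -subr_eq0; apply/eqP.
rewrite PJ -(linB PL); apply: E0; set w := P _.
have Gw : G w = w by rewrite GP.
rewrite /E Gw /w BP (P_id (GP _)) -/w BDl BNl BJ opprK.
have -> : B (br v (J a)) w = B (br (J a) w) v by rewrite Binv Bsym.
rewrite Tpos ?GJ ?Ga //= JJ brNl BNl.
by rewrite [B (br v a) _]Binv Bsym addNr.
Qed.

Let sg x v := Q (br (P x) v).
Let sgJ x v := Q (br (J (P x)) v).

(** Bracket the identity [casimir] with v, expand by the Jacobi identity, and
    pair with J v. The components in V+ of the resulting terms form the trace of
    a skew operator times a symmetric one and drop out. *)
Let sum_sg v : G v = - v -> \sum_i B (sg (e i) v) (J (sgJ (e i) v)) = 0.
Proof.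
move=> Gv; have GJv : G (J v) = - J v by rewrite GJ Gv linearN.
pose r1 x := P (br v (P x)); pose r2 x := P (br (J v) (P x)).
have r1L : linear r1 by move=> a x y; rewrite /r1 PL brLr PL.
have r2L : linear (J \o r2).
  by move=> a x y; rewrite /r2 /= PL brLr PL linearP.
have rho : \sum_i B (r1 (e i)) (J (r2 (e i))) = 0.
  rewrite (eq_bigr (fun i => E (r1 (e i)) (J (r2 (e i))))); last first.
    by move=> i _; rewrite /E /r1 GP.
  apply: (trace_skew_sym r1L r2L) => x y; rewrite /E /= /r1 /r2.
    by rewrite GP BP BG GP (brA v (P x)) BNl Binv -BP.
  rewrite GJ GP BJ BP -PJ (brA (J v) (P x)) BNl opprK Binv.
  by rewrite BG GJ GP -(comm_pos (GP y) GJv) -BP.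
have := congr1 (fun k => B (br v k) (J v)) casimir.
rewrite br0 B0l (lin_sum _ _ (@brLr v)) (lin_sum _ _ (@BL' _)).
rewrite (eq_bigr (fun i => -2 * B (r1 (e i)) (J (r2 (e i))) -
   2 * B (sg (e i) v) (J (sgJ (e i) v)))); last first.
  move=> i _; set p := P (e i); have Gp : G p = p by exact: GP.
  have GJp : G (J p) = J p by rewrite GJ Gp.
  rewrite brJac BDl [B (br (br v p) _) _]Binv [br p (br v _)]brA BNl.
  rewrite [B (br (br v (J p)) _) _]Binv [B (br v p) _]BPQ [B (br v (J p)) _]BPQ.
  (* Both terms contribute equally, whence the factors 2. *)
  have -> : P (br (J p) (J v)) = - J (r2 (e i)).
    by rewrite brA (linN PL) comm_pos.
  have -> : P (br v (J p)) = J (r1 (e i)) by rewrite comm_pos.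
  have -> : P (br p (J v)) = - r2 (e i) by rewrite brA (linN PL).
  have -> : Q (br v p) = - sg (e i) v by rewrite brA (linN QL).
  have -> : Q (br v (J p)) = - sgJ (e i) v by rewrite brA (linN QL).
  rewrite !comm_neg // -/(sg (e i) v) -/(sgJ (e i) v) -/(r1 (e i)).
  rewrite !BNl !BNr BJ [B (sgJ _ _) _]Bsym BJ.
  ring.
rewrite big_split /= -mulr_sumr rho mulr0 add0r sumrN -mulr_sumr.
move=> /eqP; rewrite oppr_eq0 mulf_eq0 pnatr_eq0 /= => /eqP; exact.
Qed.

(** The action of x - i J x on the +i eigenspace of J in V-, modulo V+. Its
    adjoint is [St x], by [S_adj]. *)
Let S x v := Q (jbr (P x) v).
Let St x v := - sg x v - J (sgJ x v).

Let SE x v : G v = - v -> S x v = sg x v - J (sgJ x v).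
Proof. by move=> Gv; rewrite /S /jbr (linB QL) comm_neg // GJ GP. Qed.

Let S_adj x v w : G v = - v -> G w = - w -> B (S x v) w = B v (St x w).
Proof.
move=> Gv Gw; rewrite SE // /St BDl BNl BDr !BNr BJ opprK /sg /sgJ.
have GJP : G (J (P x)) = J (P x) by rewrite GJ GP.
rewrite !BQ (Q_id Gw) (Q_id (_ : G (J w) = - J w)); last by rewrite GJ Gw linearN.
rewrite QJ -!BQ (Q_id Gv) (brA (P x) v) BNl Binv; congr (_ + _).
rewrite (brA _ v) BNl Binv -!BNr -[v](Q_id Gv) !BQ !(linN QL).
by rewrite comm_neg // QJ.
Qed.

Let sum_S v : G v = - v ->
  \sum_i E (St (e i) v) (St (e i) v) = \sum_i E (S (e i) v) (S (e i) v).
Proof.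
move=> Gv; apply/eqP; rewrite -subr_eq0 -sumrB.
rewrite (eq_bigr (fun i => -4 * B (sg (e i) v) (J (sgJ (e i) v)))); last first.
  move=> i _; rewrite SE // /E /St !(GB, GN, GJ) !GQ !JN !opprK !(BDl, BDr, BNl, BNr) /=.
  rewrite [B (J _) (sg _ _)]Bsym; ring.
by rewrite -mulr_sumr sum_sg // mulr0.
Qed.

Let GS x v : G (S x v) = - S x v. Proof. exact: GQ. Qed.

Let St_span v y : (forall i, St (e i) v = 0) -> St y v = 0.
Proof.
have StL : linear (St^~ v).
  move=> a x z; rewrite /St /sg /sgJ PL (linearP J) !brL !QL (linearP J).
  by rewrite scalerBr scalerN !opprD addrACA.
move=> H; rewrite [y]e_span (lin_sum _ _ StL) big1 // => i _.
by rewrite (linZ StL) H scaler0.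
Qed.

Let S_nilpotent s v : G v = - v -> size s = K.+1 -> foldr S v s = 0.
Proof.
move=> Gv; have H : foldr S v s = Q (foldr jbr v (map P s)).
  elim: s => [|x s IH] /=; first by rewrite Q_id.
  rewrite IH /S [in RHS](PQ (foldr _ _ _)) (linD (@jbrLr _)) (linD QL).
  by rewrite [Q (jbr _ (P _))]jbr_pos ?GP ?add0r.
case: s H => //= x s -> [sK].
by rewrite jbr_nilpotent ?size_map // (lin0 (@jbrLr _)) (lin0 QL).
Qed.

(** This is where definiteness enters: a sum of squares is zero. *)
Let St0 v : (forall x, S x v = 0) -> G v = - v -> forall x, St x v = 0.
Proof.
move=> Sv Gv x; apply: St_span => i; apply: E0.
have /eqP := sum_S Gv; rewrite [X in _ == X]big1; last first.
  by move=> j _; rewrite Sv /E linear0 B0l.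
rewrite psumr_eq0; last by move=> j _; exact: Ege0.
by move=> /allP /(_ i (mem_index_enum i)) /eqP.
Qed.

(** Descending induction on the length of the vanishing products of operators
    S: a product of length k + 1 takes its values in the common kernel of the S,
    hence of their adjoints, while it is also an image under S. *)
Let S_trivial x v : G v = - v -> S x v = 0.
Proof.
pose Z k := forall s w, G w = - w -> size s = k.+1 -> foldr S w s = 0.
suff Z0 : Z 0%N by move=> Gv; exact: (Z0 [:: x]).
have: Z K by move=> s w; exact: S_nilpotent.
elim: (K) => //= k IH Zk; apply: IH => -[//|y s] w Gw [sk] /=.
set u := foldr S w s; have Gu : G u = - u.
  by rewrite /u; case: (s) => //= z s'; rewrite GS.
have Su z : S z (S y u) = 0 by apply: (Zk [:: z, y & s]); rewrite //= sk.
have := St0 Su (GS _ _) y => St_u.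
by apply: E0; rewrite /E GS BNl S_adj ?GS // St_u B0r oppr0.
Qed.

(** S = 0 makes its adjoint St vanish too, and [sg] is half their difference. *)
Lemma mixed_bracket_neg a v : G a = a -> G v = - v -> Q (br a v) = 0.
Proof.
move=> Ga Gv; have Sv x : S x v = 0 by exact: S_trivial.
have := St0 Sv Gv a; have := Sv a; rewrite SE // /St => /eqP.
rewrite subr_eq0 => /eqP <-; rewrite -opprD -(mulr2n (sg a v)) => /eqP.
by rewrite oppr_eq0 -(scaler_nat 2) scaler_eq0 pnatr_eq0 /= /sg P_id // => /eqP.
Qed.

End MixedBracket.

Section QuadraticKahler.
Variables (R : rcfType) (D : lmodType R) (br : D -> D -> D) (B : D -> D -> R).
Variables (J1 J2 : {linear D -> D}).
Hypothesis brL : forall z, linear (br^~ z).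
Hypothesis brA : forall x y, br x y = - br y x.
Hypothesis brJac : forall x y z, br x (br y z) = br (br x y) z + br y (br x z).
Variable K : nat.
Hypothesis brnil : forall s x, size s = K -> foldr br x s = 0.
Hypothesis BL : forall z, scalar (B^~ z).
Hypothesis Bsym : forall x y, B x y = B y x.
Hypothesis Binv : forall x y z, B (br x y) z = B x (br y z).
Hypothesis JJ1 : forall x, J1 (J1 x) = - x.
Hypothesis JJ2 : forall x, J2 (J2 x) = - x.
Hypothesis BJ1 : forall x y, B (J1 x) (J1 y) = B x y.
Hypothesis BJ2 : forall x y, B (J2 x) (J2 y) = B x y.
Hypothesis Jint1 : forall x y,
  J1 (br x y - br (J1 x) (J1 y)) = br x (J1 y) + br (J1 x) y.
Hypothesis Jint2 : forall x y,
  J2 (br x y - br (J2 x) (J2 y)) = br x (J2 y) + br (J2 x) y.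
Hypothesis Jcomm : forall x, J1 (J2 x) = J2 (J1 x).
Hypothesis Jpos : forall x, x != 0 -> 0 < B (J1 (J2 x)) x.
Variables (N : nat) (b : 'I_N -> D).
Hypothesis b_span : forall x, exists c : 'I_N -> R, x = \sum_i c i *: b i.

Let G : {linear D -> D} := J1 \o J2.
Local Notation E := (eform B G).

Let BL' z : linear (fun x => B x z : R^o). Proof. exact: BL. Qed.
Let BDl x y z : B (x + y) z = B x z + B y z. Proof. exact: (linD (@BL' z)). Qed.
Let BNl x z : B (- x) z = - B x z. Proof. exact: (linN (@BL' z)). Qed.
Let BNr x z : B z (- x) = - B z x. Proof. by rewrite !(Bsym z) BNl. Qed.

Let BJ x y : B (J1 x) y = - B x (J1 y).
Proof. by rewrite -BJ1 JJ1 BNl. Qed.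
Let BJ' x y : B (J2 x) y = - B x (J2 y).
Proof. by rewrite -BJ2 JJ2 BNl. Qed.
Let GG x : G (G x) = x.
Proof. by rewrite /G /= -(Jcomm (J2 x)) JJ1 JJ2 opprK. Qed.
Let GJ x : G (J1 x) = J1 (G x).
Proof. by rewrite /G /= -Jcomm. Qed.
Let BG x y : B (G x) y = B x (G y).
Proof. by rewrite /G /= BJ BJ' opprK Jcomm. Qed.

Let EL z : scalar (E^~ z).
Proof. by move=> a x y; rewrite /eform linearP BL. Qed.
Let Esym x y : E x y = E y x.
Proof. by rewrite /eform BG Bsym. Qed.

Let J2_pos x : G x = x -> J2 x = - J1 x.
Proof. by move=> /(congr1 J1); rewrite /G /= JJ1 => <-; rewrite opprK. Qed.
Let J2_neg x : G x = - x -> J2 x = J1 x.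
Proof. by move=> /(congr1 J1); rewrite /G /= JJ1 linearN => /oppr_inj. Qed.

Let int1 x y z : B (br x y) z - B (br (J1 x) (J1 y)) z =
  B (br x (J1 y)) (J1 z) + B (br (J1 x) y) (J1 z).
Proof. by rewrite -BDl -Jint1 BJ1 BDl BNl. Qed.
Let int2 x y z : B (br x y) z - B (br (J2 x) (J2 y)) z =
  B (br x (J2 y)) (J2 z) + B (br (J2 x) y) (J2 z).
Proof. by rewrite -BDl -Jint2 BJ2 BDl BNl. Qed.

Let brNl x z : br (- x) z = - br x z. Proof. exact: (linN (@brL z)). Qed.
Let brNr x z : br z (- x) = - br z x. Proof. by rewrite brA brNl -brA. Qed.

(** The exponent s is even when x and y are in V+ and z in V-, and odd in the
    opposite case. The relations [int1] and [int2] then differ only by the sign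
    of their right-hand sides. *)
Let T x y z s : G x = (-1) ^+ s *: x -> G y = (-1) ^+ s *: y ->
  G z = - ((-1) ^+ s *: z) -> B (br x y) z = B (br (J1 x) (J1 y)) z.
Proof.
have := int1 x y z; have := int2 x y z; case: (odd s) (signr_odd R s) => /= <-.
  rewrite expr1 !scaleN1r opprK => + + /J2_neg Jx /J2_neg Jy /J2_pos Jz.
  rewrite Jx Jy Jz !BNr; lra.
rewrite expr0 !scale1r => + + /J2_pos Jx /J2_pos Jy /J2_neg Jz.
rewrite Jx Jy Jz !(brNl, brNr) !BNl opprK; lra.
Qed.

Let orthobasis : exists m (e : 'I_m -> D),
  (forall i j, E (e i) (e j) = (i == j)%:R) /\
  (forall x, x = \sum_i E x (e i) *: e i).
Proof.
have [os [uos oos sos]] := orthonormal_family EL Esym Jpos (codom b).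
exists (size os), (fun i => nth 0 os i); split=> [i j|x].
  by rewrite oos ?mem_nth // nth_uniq.
have EL' z : linear (fun x => E x z : R^o) by exact: EL.
have [c ->] := b_span x.
under [RHS]eq_bigr do rewrite (lin_sum _ _ (EL' _)) scaler_suml.
rewrite exchange_big /=; apply: eq_bigr => i _.
rewrite {1}(sos (b i)) ?codom_f // scaler_sumr (big_nth 0) big_mkord.
by apply: eq_bigr => j _; rewrite (linZ (EL' _)) scalerA.
Qed.

Let mixed a v : G a = a -> G v = - v -> br a v = 0.
Proof.
have [m [e [e_on e_span]]] := orthobasis.
move=> Ga Gv.
have /eqP : proj_neg G (br a v) = 0.
  apply: (mixed_bracket_neg brL brA brJac brnil BL Bsym Binv JJ1 BJ _ GG GJ BG
     Jpos _ _ e_on e_span) => //.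
  - by move=> x y z Gx Gy Gz; apply: (@T _ _ _ 0); rewrite expr0 scale1r.
  - by move=> x y z Gx Gy Gz; apply: (@T _ _ _ 1); rewrite expr1 scaleN1r ?opprK.
(* The other component of [a, v] comes from the same lemma for the opposite
   pairing and - G, which exchange V+ and V- and keep the inner product. *)
pose G' : {linear D -> D} := \- G; have GE x : G' x = - G x by [].
have /eqP : proj_neg G' (br v a) = 0.
  apply: (@mixed_bracket_neg _ _ br (fun x y => - B x y) J1 G' brL brA brJac
    K brnil _ _ _ JJ1 _ _ _ _ _ _ _ _ m e) => //.
  - by move=> z k x y; rewrite BL opprD mulrN.
  - by move=> x y; rewrite Bsym.
  - by move=> x y z; rewrite Binv.
  - by move=> x y; rewrite BJ.
  - by move=> x; rewrite !GE (linearN G) opprK GG.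
  - by move=> x; rewrite !GE GJ (linearN J1).
  - by move=> x y; rewrite !GE BNl BNr BG.
  - by move=> x /Jpos; rewrite /eform GE BNl opprK.
  - move=> x y z; rewrite !GE => /eqP; rewrite eqr_oppLR => /eqP Gx /eqP.
    rewrite eqr_oppLR => /eqP Gy /oppr_inj Gz; congr (- _).
    by apply: (@T _ _ _ 1); rewrite expr1 scaleN1r ?opprK.
  - move=> x y z; rewrite !GE => /oppr_inj Gx /oppr_inj Gy /eqP.
    rewrite eqr_oppLR => /eqP Gz; congr (- _).
    by apply: (@T _ _ _ 0); rewrite expr0 scale1r.
  - by move=> i j; rewrite -e_on /eform GE BNl opprK.
  - move=> x; rewrite [LHS]e_span; apply: eq_bigr => i _.
    by rewrite /eform GE BNl opprK.
  - by rewrite GE Gv opprK.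
  - by rewrite GE Ga.
rewrite /proj_neg GE !scaler_eq0 invr_eq0 pnatr_eq0 !orFb (brA v).
set w := br a v => H1; rewrite subr_eq0 => /eqP Gw; move: H1.
rewrite (linearN G) -Gw opprK -opprD oppr_eq0 -mulr2n -(scaler_nat 2).
by rewrite scaler_eq0 pnatr_eq0 /= => /eqP.
Qed.

Let GN x : G (- x) = - G x. Proof. exact: linearN. Qed.
Let GL : linear G. Proof. exact: linearP. Qed.
Let GPQ x : [/\ G (proj_pos G x) = proj_pos G x,
  G (proj_neg G x) = - proj_neg G x & x = proj_pos G x + proj_neg G x].
Proof.
rewrite /proj_pos /proj_neg; split.
- by rewrite (linZ GL) (linD GL) GG addrC.
- by rewrite (linZ GL) (linB GL) GG -scalerN opprB.
rewrite -scalerDr addrACA subrr addr0 -mulr2n -(scaler_nat 2 x) scalerA.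
by rewrite mulVf ?scale1r ?pnatr_eq0.
Qed.

Let E0 x : E x x = 0 -> x = 0.
Proof. by move=> Ex; apply: contra_eq Ex => /Jpos; rewrite lt0r => /andP[]. Qed.

Let br_pos a a' : G a = a -> G a' = a' -> G (br a a') = br a a'.
Proof.
move=> Ga Ga'; have [_ Gq {2}->] := GPQ (br a a').
have -> : G (br a a') = G (proj_pos G (br a a') + proj_neg G (br a a')).
  by congr (G _); have [] := GPQ (br a a').
suff -> : proj_neg G (br a a') = 0 by rewrite addr0; have [] := GPQ (br a a').
set q := proj_neg G _ in Gq *.
have brq : B (br a a') q = 0 by rewrite Binv mixed // Bsym (lin0 (@BL' _)).
apply: E0; rewrite /eform Gq BNl {1}/q /proj_neg (linZ (@BL' _)) BDl BNl.
by rewrite BG Gq BNr brq !oppr0 addr0 scaler0 oppr0.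
Qed.

Let br_neg a a' : G a = - a -> G a' = - a' -> G (br a a') = - br a a'.
Proof.
move=> Ga Ga'; have [Gp _ {2}->] := GPQ (br a a').
have -> : G (br a a') = G (proj_pos G (br a a') + proj_neg G (br a a')).
  by congr (G _); have [] := GPQ (br a a').
suff -> : proj_pos G (br a a') = 0 by rewrite add0r; have [] := GPQ (br a a').
set q := proj_pos G _ in Gp *.
have brq : B (br a a') q = 0.
  by rewrite Binv brA mixed // oppr0 Bsym (lin0 (@BL' _)).
apply: E0; rewrite /eform Gp {1}/q /proj_pos (linZ (@BL' _)) BDl.
by rewrite BG Gp brq addr0 scaler0.
Qed.

Let brDl x y z : br (x + y) z = br x z + br y z. Proof. exact: (linD (@brL z)). Qed.
Let brDr x y z : br z (x + y) = br z x + br z y.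
Proof. by rewrite brA brDl opprD -!brA. Qed.

Let Gbr x z : G (br x z) = br x (G z).
Proof.
have [xp xn ->] := GPQ x; have [zp zn ->] := GPQ z.
set a := proj_pos G x in xp *; set a' := proj_neg G x in xn *.
set c := proj_pos G z in zp *; set c' := proj_neg G z in zn *.
rewrite (linD GL) zp zn !brDl !brDr !brNr (brA a' c) (mixed xp zn) (mixed zp xn).
rewrite !oppr0 !addr0 !add0r (linD GL).
by rewrite br_pos // br_neg.
Qed.

(** Once V+ and V- commute, G commutes with every ad x, so the inner product
    <G x, y> is ad-invariant. Then a bracket [u, w] that commutes with u has
    squared norm - <w, [u, [u, w]]> = 0, and nilpotency propagates this down to all
    brackets. *)
Theorem nilpotent_quadratic_kahler_abelian x y : br x y = 0.
Proof.
have brE u v w : E (br u v) w = - E v (br u w).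
  by rewrite /eform Gbr brA BNl Binv.
pose Z k := forall s v, size s = k.+1 -> foldr br v s = 0.
suff Z0 : Z 0%N by exact: (Z0 [:: x]).
have br0 u : br u 0 = 0 by exact: (lin0 (@brLr _ _ br brL brA u)).
have: Z K.
  by case=> //= u s v [sK]; rewrite brnil.
elim: (K) => //= k IH Zk; apply: IH => -[//|u s] v [sk] /=.
apply: E0; rewrite brE.
have -> : br u (br u (foldr br v s)) = 0 by apply: (Zk [:: u, u & s]); rewrite /= sk.
rewrite Esym (@lin0 _ _ _ (fun x => E x _ : R^o)) ?oppr0 // => a w w'; exact: EL.
Qed.

End QuadraticKahler.

(** * The Courant algebra of a Lie algebra *)

Section Pairing.
Context {R : realType} {n : nat}.
Implicit Types x y z : 'rV[R]_n.

Lemma pairingL z : scalar (fun x => pairing x z).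
Proof.
move=> a x y; rewrite /pairing mulr_sumr -big_split; apply: eq_bigr => i _.
by rewrite !mxE mulrDl mulrA.
Qed.

Lemma pairingC x y : pairing x y = pairing y x.
Proof. by apply: eq_bigr => i _; rewrite mulrC. Qed.

Lemma pairingDl x y z : pairing (x + y) z = pairing x z + pairing y z.
Proof. by have := pairingL z 1 x y; rewrite scale1r mul1r. Qed.
Lemma pairingDr x y z : pairing z (x + y) = pairing z x + pairing z y.
Proof. by rewrite !(pairingC z) pairingDl. Qed.
Lemma pairing0l z : pairing 0 z = 0.
Proof. by rewrite /pairing big1 // => i _; rewrite mxE mul0r. Qed.
Lemma pairing0r z : pairing z 0 = 0.
Proof. by rewrite pairingC pairing0l. Qed.
Lemma pairingZl a x z : pairing (a *: x) z = a * pairing x z.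
Proof. by have := pairingL z a x 0; rewrite !addr0 pairing0l addr0. Qed.
Lemma pairingZr a x z : pairing z (a *: x) = a * pairing z x.
Proof. by rewrite !(pairingC z) pairingZl. Qed.
Lemma pairingNl x z : pairing (- x) z = - pairing x z.
Proof. by rewrite -scaleN1r pairingZl mulN1r. Qed.
Lemma pairingNr x z : pairing z (- x) = - pairing z x.
Proof. by rewrite !(pairingC z) pairingNl. Qed.

Lemma pairing_delta x j : pairing x (ebase j) = x ord0 j.
Proof.
rewrite /pairing (bigD1 j) //= mxE !eqxx mulr1 big1 ?addr0 // => i /negPf ij.
by rewrite mxE ij andbF mulr0.
Qed.

Lemma pairing_ext x y : (forall z, pairing x z = pairing y z) -> x = y.
Proof. by move=> H; apply/rowP => j; rewrite -!pairing_delta H. Qed.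

Lemma row_sum_ebase x : x = \sum_j x ord0 j *: ebase j.
Proof. exact: row_sum_delta. Qed.

End Pairing.

Section CourantAlgebra.
Context {R : realType} {n : nat}.
Variable br : 'rV[R]_n -> 'rV[R]_n -> 'rV[R]_n.
Hypothesis brL : forall z, linear (br^~ z).
Hypothesis brA : forall x y, br x y = - br y x.
Hypothesis brJac : forall x y z, br x (br y z) = br (br x y) z + br y (br x z).
Variable K : nat.
Hypothesis brnil : forall s x, size s = K -> foldr br x s = 0.

(** The value at the identity of the Courant bracket of the left-invariant
    sections with values x and y there, when [br] is the bracket of g:
    left-invariant forms satisfy d eta (u, w) = - eta [u, w], and the last term of the Courant
    bracket is the differential of a constant. *)
Definition courant_alg (x y : gvec R n) : gvec R n :=
  (br x.1 y.1,
   \row_j (pairing x.2 (br y.1 (ebase j)) - pairing y.2 (br x.1 (ebase j)))).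
Local Notation crt := courant_alg.

Let brLr z : linear (br z). Proof. exact: brLr. Qed.

Lemma pairing_crt x y w :
  pairing (crt x y).2 w = pairing x.2 (br y.1 w) - pairing y.2 (br x.1 w).
Proof.
rewrite [w in RHS]row_sum_ebase !(lin_sum _ _ (@brLr _)).
have pL (z : 'rV[R]_n) : linear (pairing z : 'rV[R]_n -> R^o).
  by move=> a u v; rewrite pairingDr pairingZr.
rewrite !(lin_sum _ _ (pL _)) -sumrB; apply: eq_bigr => j _.
by rewrite !(linZ (@brLr _)) !pairingZr mxE mulrC mulrBr.
Qed.

Let brD x y z : br (x + y) z = br x z + br y z. Proof. exact: (linD (@brL z)). Qed.
Let brZ a x z : br (a *: x) z = a *: br x z. Proof. exact: (linZ (@brL z)). Qed.

Lemma gvec_ext (x y : gvec R n) :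
  x.1 = y.1 -> (forall w, pairing x.2 w = pairing y.2 w) -> x = y.
Proof. by case: x y => u a [v b] /= -> /pairing_ext ->. Qed.

Lemma courant_algNl x y : crt (- x) y = - crt x y.
Proof.
apply: gvec_ext => [|w]; first exact: (linN (@brL y.1)).
rewrite [RHS]pairingNl !pairing_crt /= pairingNl (linN (@brL w)).
by rewrite pairingNr opprB opprK addrC.
Qed.

Lemma courant_algNr x y : crt x (- y) = - crt x y.
Proof.
apply: gvec_ext => [|w]; first exact: (linN (@brLr x.1)).
rewrite [RHS]pairingNl !pairing_crt /= pairingNl (linN (@brL w)).
by rewrite pairingNr opprB opprK addrC.
Qed.

(** The right-hand side is invariant under cyclic permutations of x, y, z,
    which gives the ad-invariance of the pairing. *)
Lemma ginner_crt x y z : ginner (crt x y) z =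
  2^-1 * (pairing x.2 (br y.1 z.1) + pairing y.2 (br z.1 x.1)
          + pairing z.2 (br x.1 y.1)).
Proof.
by rewrite /ginner pairing_crt (brA z.1) pairingNr.
Qed.

Lemma ginnerC (x y : gvec R n) : ginner x y = ginner y x.
Proof. by rewrite /ginner addrC. Qed.

Theorem gk_algebra_abelian (J1 J2 : gvec R n -> gvec R n) :
  linear J1 -> linear J2 ->
  (forall x, J1 (J1 x) = - x) -> (forall x, J2 (J2 x) = - x) ->
  (forall x y, ginner (J1 x) (J1 y) = ginner x y) ->
  (forall x y, ginner (J2 x) (J2 y) = ginner x y) ->
  (forall x y, J1 (crt x y - crt (J1 x) (J1 y)) = crt x (J1 y) + crt (J1 x) y) ->
  (forall x y, J2 (crt x y - crt (J2 x) (J2 y)) = crt x (J2 y) + crt (J2 x) y) ->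
  (forall x, J1 (J2 x) = J2 (J1 x)) ->
  (forall x, x != 0 -> 0 < ginner (J1 (J2 x)) x) ->
  forall x y, br x y = 0.
Proof.
move=> J1L J2L JJ1 JJ2 BJ1 BJ2 int1 int2 comm pos.
pose j1 : {linear gvec R n -> gvec R n} :=
  HB.pack J1 (GRing.isLinear.Build _ _ _ _ J1 J1L).
pose j2 : {linear gvec R n -> gvec R n} :=
  HB.pack J2 (GRing.isLinear.Build _ _ _ _ J2 J2L).
suff H x y : crt x y = 0 by move=> x y; have := congr1 fst (H (x, 0) (y, 0)).
have crtA u v : crt u v = - crt v u.
  apply: gvec_ext => [|w]; first by rewrite /= brA.
  by rewrite /= pairingNl [RHS](congr1 -%R (pairing_crt _ _ _)) pairing_crt opprB.
refine (@nilpotent_quadratic_kahler_abelian R (gvec R n) crt ginner j1 j2 _ crtA _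
  (K + K)%N _ _ _ _ JJ1 JJ2 BJ1 BJ2 int1 int2 comm pos (n + n)%N
  (fun k : 'I_(n + n) => match fintype.split k with inl i => (ebase i, 0) | inr i => (0, ebase i) end) _ x y).
- move=> z a u v; apply: gvec_ext => [|w]; first exact: brL.
  rewrite pairing_crt [RHS]pairingDl pairingZl !pairing_crt /=.
  rewrite brD brZ !pairingDl !pairingZl !pairingDr !pairingZr; ring.
- move=> u v w; apply: gvec_ext => [|t]; first exact: brJac.
  rewrite [RHS]pairingDl !pairing_crt /=.
  have H a b : br (br a b) t = br a (br b t) - br b (br a t).
    by rewrite brJac addrK.
  rewrite !H !(pairingDr, pairingNr); ring.
(* K brackets annihilate the vector part; on covectors alone a bracket acts
   by the transpose of ad, so K further ones annihilate the covector part. *)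
- move=> s u; have foldr1 t z : (foldr crt z t).1 = foldr br z.1 (map fst t).
    by elim: t => //= a t ->.
  have foldr2 t (z : gvec R n) w : z.1 = 0 -> (foldr crt z t).1 = 0 /\
      pairing (foldr crt z t).2 w =
      (-1) ^+ size t * pairing z.2 (foldr br w (rev (map fst t))).
    move=> z0; elim: t w => [|a t IH] w; first by rewrite mul1r.
    split; first by rewrite /= (IH w).1 (lin0 (@brLr _)).
    rewrite [foldr _ _ _]/= pairing_crt (IH w).1 (lin0 (@brL _)) pairing0r sub0r.
    rewrite (IH _).2 /= rev_cons foldr_rcons exprS mulN1r mulNr //.
  move=> sK; rewrite -(cat_take_drop K s) foldr_cat.
  set z := foldr _ u _.
  have z0 : z.1 = 0.
    by rewrite foldr1 brnil // size_map size_drop sK addnK.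
  apply: gvec_ext => [|w]; first by rewrite (foldr2 _ _ 0 z0).1.
  rewrite (foldr2 _ _ w z0).2 brnil ?pairing0r ?mulr0 ?pairing0l //.
  by rewrite size_rev size_map size_take sK; case: ltngtP (leq_addr K K).
- by move=> z a u v; rewrite /ginner /= pairingDl pairingDr pairingZl pairingZr; ring.
- exact: ginnerC.
- move=> u v w; rewrite ginner_crt ginnerC ginner_crt.
  by congr (_ * _); rewrite [RHS]addrC addrA.
- move=> u; exists (fun k : 'I_(n + n) => match fintype.split k with inl i => u.1 ord0 i | inr i => u.2 ord0 i end).
  rewrite big_split_ord /=.
  under eq_bigr => i _ do rewrite -[lshift _ _]/(unsplit (inl i)) unsplitK.
  under [X in _ + X]eq_bigr => i _ do rewrite -[rshift _ _]/(unsplit (inr i)) unsplitK.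
  apply: gvec_ext => [|w].
    rewrite /= !(raddf_sum fst) /= [X in _ + X]big1 ?addr0; last by move=> *; rewrite scaler0.
    exact: row_sum_ebase.
  congr pairing.
  rewrite /= !(raddf_sum snd) /= [X in X + _]big1 ?add0r; last by move=> *; rewrite scaler0.
  exact: row_sum_ebase.
Qed.

End CourantAlgebra.

(** * Calculus of maps of class C^k *)

Local Open Scope classical_set_scope.
Local Open Scope ring_scope.

Section DeriveRules.
Context {R : realType}.
Implicit Types U V W : normedModType R.

Lemma derive_comp U V W (f : U -> V) (g : V -> W) x v :
  differentiable f x -> differentiable g (f x) ->
  'D_v (g \o f) x = 'D_('D_v f x) g (f x).
Proof.
move=> df dg; rewrite !deriveE //; last exact: differentiable_comp.
by rewrite diff_comp.
Qed.

Lemma derive_linear V W (f : V -> W) x : differentiable f x ->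
  linear (fun v => 'D_v f x).
Proof. by move=> df a u v; rewrite !deriveE // linearP. Qed.

Lemma derive_pair U V W (f : U -> V) (g : U -> W) x v :
  differentiable f x -> differentiable g x ->
  'D_v (fun y => (f y, g y)) x = ('D_v f x, 'D_v g x).
Proof.
by move=> df dg; rewrite !deriveE // ?diff_pair //; exact: differentiable_pair.
Qed.

Lemma derive_coord V n (f : V -> 'rV[R]_n) x v i : differentiable f x ->
  ('D_v f x) ord0 i = 'D_v (fun y => f y ord0 i) x.
Proof. by move=> df; rewrite derive_mx ?mxE //; exact: diff_derivable. Qed.

Lemma differentiable_rowP V n (f : V -> 'rV[R]_n) x :
  (forall i, differentiable (fun y => f y ord0 i) x) -> differentiable f x.
Proof.
move=> df; have -> : f = \sum_i (fun y => f y ord0 i *: (delta_mx 0 i : 'rV_n)).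
  by apply/funext => y; rewrite fct_sumE; exact: row_sum_delta.
apply: (@differentiable_sum _ _ _ n (fun i y => f y ord0 i *: (delta_mx 0 i : 'rV_n))).
move=> i; exact: (@differentiableZl R V 'rV[R]_n (fun y => f y ord0 i)).
Qed.

Lemma differentiable_entry V n (f : V -> 'rV[R]_n) x i :
  differentiable f x -> differentiable (fun y => f y ord0 i) x.
Proof.
move=> df; apply: (@differentiable_comp _ _ _ _ f (fun N : 'rV[R]_n => N ord0 i)) => //.
exact: differentiable_coord.
Qed.

(** Holds for every f, differentiable or not, as both sides are the limit of
    the same quotient. *)
Lemma derive_affine U V W (A : U -> V) (L : U -> V) (f : V -> W) x v :
  (forall h : R, A (h *: v + x) = h *: L v + A x) ->
  'D_v (f \o A) x = 'D_(L v) f (A x).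
Proof. by move=> AL; rewrite /derive; under eq_fun => h do rewrite /= AL. Qed.

End DeriveRules.


(** The difference g - f is zero near x, hence has differential 0 there. *)
Lemma near_eq_differentiable {R : realType} (V W : normedModType R) (f g : V -> W) x :
  (\near x, f x = g x) -> differentiable f x -> differentiable g x.
Proof.
move=> fg df; have -> : g = f + (g - f) by rewrite addrC subrK.
apply: differentiableD => //; set h := g - f.
have h0 : h \o shift x = cst (h x) + (\0 : V -> W) +o_ 0 id.
  apply/eqaddoP => e e0.
  have : \forall y \near 0, f (y + x) = g (y + x).
    by move: fg; rewrite (near_shift 0) /=; apply: filterS => y; rewrite subr0.
  apply: filterS => y fgy; rewrite /h /=.
  rewrite !fctE /= fgy (nbhs_singleton fg) !subrr addr0 subr0 normr0.
  by rewrite mulr_ge0 // ltW.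
have c0 : continuous (\0 : V -> W) by move=> y; exact: cvg_cst.
by apply/diff_locallyP; rewrite (diff_unique c0 h0).
Qed.

Section CkRules.
Context {R : realType}.
Implicit Types U V W : normedModType R.

Lemma Ck_ext V W (k : nat) (O : set V) (f g : V -> W) : open O ->
  (forall x, O x -> f x = g x) -> Ck k O f -> Ck k O g.
Proof.
move=> oO; elim: k f g => [|k IH] f g fg /=.
  move=> cf x Ox; have := cf x Ox; rewrite /prop_for /continuous_at -(fg x Ox).
  apply: cvg_trans.
  apply: near_eq_cvg; apply: filterS (open_nbhs_nbhs (conj oO Ox)) => y Oy.
  exact: fg.
have nfg x : O x -> \near x, f x = g x.
  by move=> Ox; apply: filterS (open_nbhs_nbhs (conj oO Ox)) => y; exact: fg.
move=> [df Df]; split=> [x Ox|v].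
  exact: near_eq_differentiable (nfg x Ox) (df x Ox).
by apply: IH (Df v) => x Ox; exact/near_eq_derive/nfg.
Qed.

Lemma Ck_succ V W k (O : set V) (f : V -> W) : Ck k.+1 O f -> Ck k O f.
Proof.
elim: k f => [|k IH] f [df Df]; first by move=> x /df /differentiable_continuous.
by split=> // v; exact/IH/Df.
Qed.

Lemma Ck_subset V W k (O O' : set V) (f : V -> W) :
  O' `<=` O -> Ck k O f -> Ck k O' f.
Proof.
move=> OO; elim: k f => [|k IH] f /=; first by move=> cf x /OO; exact: cf.
by move=> [df Df]; split=> [x /OO|v]; [exact: df|exact/IH/Df].
Qed.

Lemma Ck_cst V W k (O : set V) (c : W) : Ck k O (fun=> c).
Proof.
elim: k c => [|k IH] c /=; first by move=> x _; exact: cvg_cst.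
split=> [x _|v]; first exact: differentiable_cst.
by under eq_fun do rewrite derive_cst.
Qed.

Lemma Ck_add V W k (O : set V) (f g : V -> W) : open O ->
  Ck k O f -> Ck k O g -> Ck k O (fun x => f x + g x).
Proof.
move=> oO; elim: k f g => [|k IH] f g /=.
  by move=> cf cg x Ox; apply: cvgD; [exact: cf|exact: cg].
move=> [df Df] [dg Dg]; split=> [x Ox|v].
  by apply: differentiableD; [exact: df|exact: dg].
apply: (Ck_ext oO _ (IH _ _ (Df v) (Dg v))) => x Ox.
by rewrite deriveD //; apply: diff_derivable; [exact: df|exact: dg].
Qed.

Lemma Ck_mul V k (O : set V) (f g : V -> R) : open O ->
  Ck k O f -> Ck k O g -> Ck k O (fun x => f x * g x).
Proof.
move=> oO; elim: k f g => [|k IH] f g.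
  by move=> cf cg x Ox; apply: cvgM; [exact: cf|exact: cg].
move=> Cf Cg; have [df Df] := Cf; have [dg Dg] := Cg; split=> [x Ox|v].
  by apply: differentiableM; [exact: df|exact: dg].
have := Ck_add oO (IH _ _ (Ck_succ Cf) (Dg v)) (IH _ _ (Ck_succ Cg) (Df v)).
apply: Ck_ext => // x Ox; rewrite deriveM //.
- by apply: diff_derivable; exact: df.
- by apply: diff_derivable; exact: dg.
Qed.

Lemma Ck_sum V W k (O : set V) I (r : seq I) (P : pred I) (f : I -> V -> W) :
  open O -> (forall i, Ck k O (f i)) -> Ck k O (fun x => \sum_(i <- r | P i) f i x).
Proof.
move=> oO Cf; elim: r => [|i r IH].
  by under eq_fun do rewrite big_nil; exact: Ck_cst.
under eq_fun do rewrite big_cons.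
by case: (P i) => //; exact: Ck_add.
Qed.

Lemma Ck_prod V k (O : set V) I (r : seq I) (P : pred I) (f : I -> V -> R) :
  open O -> (forall i, Ck k O (f i)) -> Ck k O (fun x => \prod_(i <- r | P i) f i x).
Proof.
move=> oO Cf; elim: r => [|i r IH].
  by under eq_fun do rewrite big_nil; exact: Ck_cst.
under eq_fun do rewrite big_cons.
by case: (P i) => //; exact: Ck_mul.
Qed.

Lemma Ck_inv V k (O : set V) (f : V -> R) : open O ->
  (forall x, O x -> f x != 0) -> Ck k O f -> Ck k O (fun x => (f x)^-1).
Proof.
move=> oO f0; elim: k => [|k IH].
  by move=> cf x Ox; apply: cvgV; [exact: f0|exact: cf].
move=> Cf; have [df Df] := Cf; split=> [x Ox|v].
  by apply: differentiableV; [exact: df|exact: f0].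
have Ci := IH (Ck_succ Cf).
have := Ck_mul oO (Ck_mul oO (Ck_cst _ _ (-1 : R)) (Ck_mul oO Ci Ci)) (Df v).
apply: Ck_ext => // x Ox; rewrite deriveV ?f0 //; last exact/diff_derivable/df.
by rewrite mulN1r -expr2 exprVn.
Qed.

Lemma Ck_pair U V W k (O : set U) (f : U -> V) (g : U -> W) : open O ->
  Ck k O f -> Ck k O g -> Ck k O (fun x => (f x, g x)).
Proof.
move=> oO; elim: k f g => [|k IH] f g /=.
  by move=> cf cg x Ox; apply: cvg_pair; [exact: cf|exact: cg].
move=> [df Df] [dg Dg]; split=> [x Ox|v].
  by apply: differentiable_pair; [exact: df|exact: dg].
apply: (Ck_ext oO _ (IH _ _ (Df v) (Dg v))) => x Ox.
by rewrite derive_pair //; [exact: df|exact: dg].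
Qed.

Lemma Ck_entry V n k (O : set V) (f : V -> 'rV[R]_n) i : open O ->
  Ck k O f -> Ck k O (fun x => f x ord0 i).
Proof.
move=> oO; elim: k f => [|k IH] f /=.
  move=> cf x Ox; apply: (@continuous_comp _ _ _ f (fun N : 'rV[R]_n => N ord0 i)).
    exact: cf.
  exact: coord_continuous.
move=> [df Df]; split=> [x Ox|v]; first by apply: differentiable_entry; exact: df.
apply: (Ck_ext oO _ (IH _ (Df v))) => x Ox.
by rewrite derive_coord //; exact: df.
Qed.

Lemma Ck_scale V W k (O : set V) (f : V -> R) (w : W) : open O ->
  Ck k O f -> Ck k O (fun x => f x *: w).
Proof.
move=> oO; elim: k f => [|k IH] f /=.
  by move=> cf x Ox; apply: cvgZr_tmp; exact: cf.
move=> [df Df]; split=> [x Ox|v]; first by apply: differentiableZl; exact: df.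
apply: (Ck_ext oO _ (IH _ (Df v))) => x Ox.
have dfx := df x Ox.
by rewrite !deriveE ?diffZl //; exact: differentiableZl.
Qed.

Lemma Ck_row V n k (O : set V) (f : V -> 'rV[R]_n) : open O ->
  (forall i, Ck k O (fun x => f x ord0 i)) -> Ck k O f.
Proof.
move=> oO Cf; have -> : f = fun x => \sum_i f x ord0 i *: (delta_mx 0 i : 'rV_n).
  by apply/funext => x; exact: row_sum_delta.
by apply: Ck_sum => // i; exact: Ck_scale.
Qed.

Lemma Ck_affine U V W k (O : set V) (A : U -> V) (L : U -> V) (f : V -> W) :
  (forall x, differentiable A x) ->
  (forall x v (h : R), A (h *: v + x) = h *: L v + A x) ->
  Ck k O f -> Ck k (A @^-1` O) (f \o A).
Proof.
move=> dA AL; elim: k f => [|k IH] f /=.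
  move=> cf x Ox; apply: continuous_comp; last exact: cf.
  exact: differentiable_continuous.
move=> [df Df]; split=> [x Ox|v]; first by apply: differentiable_comp; last exact: df.
have -> : (fun x => 'D_v (f \o A) x) = (fun x => 'D_(L v) f x) \o A.
  by apply/funext => x /=; exact: derive_affine.
exact: IH.
Qed.

Lemma smooth_derive V W (O : set V) (f : V -> W) v :
  smooth_on O f -> smooth_on O (fun x => 'D_v f x).
Proof. by move=> sf k; have [_] := sf k.+1; exact. Qed.

Lemma smooth_differentiable V W (O : set V) (f : V -> W) x :
  smooth_on O f -> O x -> differentiable f x.
Proof. by move=> sf; have [+ _] := sf 1%N; exact. Qed.

End CkRules.

(** * Symmetry of second derivatives *)

Section Schwarz.
Context {R : realType} {V : normedModType R}.

Lemma MVT_line (F : V -> R) p w (h : R) : 0 < h ->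
  (forall s, 0 <= s <= h -> differentiable F (s *: w + p)) ->
  exists2 s, 0 <= s <= h & F (h *: w + p) - F p = h * 'D_w F (s *: w + p).
Proof.
move=> h0 dF; pose A s : V := s *: w + p.
have dA s : differentiable A s.
  by apply: differentiableD => //; apply: differentiableZl.
have dFA s : s \in `[0, h] -> differentiable (F \o A) s.
  by move=> sh; apply: differentiable_comp => //; apply: dF; move: sh; rewrite in_itv.
have [s sh Fs] : exists2 s, s \in `]0, h[ & (F \o A) h - (F \o A) 0 = 'D_w F (A s) * (h - 0).
  apply: MVT => // [s sh|].
    have -> : 'D_w F (A s) = 'D_1 (F \o A) s.
      rewrite (@derive_affine R _ _ _ A (fun t => t *: w)) ?scale1r // => k.
      by rewrite /A scalerDl ?scale1r [k *: 1]mulr1 addrA.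
    apply/derivableP/diff_derivable/dFA.
    by move: sh; rewrite !in_itv /= => /andP[/ltW -> /ltW ->].
  apply: derivable_within_continuous => s sh.
  exact/diff_derivable/dFA.
exists s; first by move: sh; rewrite in_itv /= => /andP[/ltW -> /ltW ->].
by move: Fs; rewrite subr0 mulrC /= /A scale0r add0r.
Qed.

(** Two applications of the mean value theorem, first along u and then along
    v, turn the second difference into h^2 times the second derivative at a
    point of the parallelogram. *)
Lemma second_difference (f : V -> R) (O : set V) x u v (e : R) : open O -> O x ->
  Ck 2 O f -> 0 < e ->
  exists2 d : R, 0 < d & forall h, 0 < h < d ->
    `|f (h *: u + (h *: v + x)) - f (h *: u + x) - f (h *: v + x) + f x
      - h ^+ 2 * 'D_v (fun y => 'D_u f y) x| <= e * h ^+ 2.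
Proof.
move=> oO Ox [df Df] e0; have [dDu Duv] := Df u.
set g := fun y => 'D_v (fun z => 'D_u f z) y.
have gc : {for x, continuous g} by exact: Duv.
have nO := open_nbhs_nbhs (conj oO Ox).
move/cvgrPdist_le : gc => /(_ _ e0) ge.
have : nbhs x (O `&` [set y | `|g x - g y| <= e]) by exact: filterI.
move=> /nbhs_ballP [r /= r0 rO].
(* Any h < r / c keeps the parallelogram with sides h u and h v in the ball;
   the summand 1 makes c positive. *)
pose c := `|u| + `|v| + 1; have c0 : 0 < c by rewrite /c ltr_wpDl // addr_ge0.
exists (r / c); first by rewrite divr_gt0.
move=> h /andP[h0]; rewrite ltr_pdivlMr // => hr.
have inb s t : 0 <= s <= h -> 0 <= t <= h -> ball x r (s *: u + (t *: v + x)).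
  move=> /andP[s0 sh] /andP[t0 th]; rewrite -ball_normE /ball_ /=.
  rewrite addrA opprD addrCA subrr addr0 normrN.
  apply: le_lt_trans hr; apply: (le_trans (ler_normD _ _)).
  rewrite !normrZ !ger0_norm // /c !mulrDr mulr1 -addrA.
  apply: lerD; first by rewrite ler_wpM2r.
  by rewrite -[leLHS]addr0; apply: lerD; [rewrite ler_wpM2r|exact: ltW].
have hh : 0 <= h <= h by rewrite ltW // lexx.
have h00 : 0 <= (0 : R) <= h by rewrite lexx ltW.
pose F y := f (y + h *: v) - f y.
have Fd y : O (y + h *: v) -> O y -> differentiable F y /\
    'D_u F y = 'D_u f (y + h *: v) - 'D_u f y.
  move=> Oyv Oy; have d1 : differentiable (fun z => f (z + h *: v)) y.
    by apply: (@differentiable_comp _ _ _ _ (fun z => z + h *: v) f) => //; exact: df.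
  split; first by apply: differentiableB => //; exact: df.
  rewrite deriveB ?(diff_derivable _ d1) //; try by apply: diff_derivable => //; exact: df.
  congr (_ - _); rewrite (@derive_affine _ _ _ _ (fun z => z + h *: v) id) // => k.
  by rewrite addrA.
have inO s t : 0 <= s <= h -> 0 <= t <= h -> O (s *: u + (t *: v + x)).
  by move=> sh th; have [] := rO _ (inb s t sh th).
have inO0 s : 0 <= s <= h -> O (s *: u + x).
  by move=> sh; have := inO s 0 sh h00; rewrite scale0r add0r.
have inOv s : 0 <= s <= h -> O (s *: u + x + h *: v).
  by move=> sh; have := inO s h sh hh; rewrite -addrA [x + _]addrC.
have [s sh Fs] := MVT_line h0 (fun s sh => (Fd _ (inOv s sh) (inO0 s sh)).1).
rewrite (Fd _ (inOv s sh) (inO0 s sh)).2 in Fs.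
have [t th Gt] : exists2 t, 0 <= t <= h &
    'D_u f (h *: v + (s *: u + x)) - 'D_u f (s *: u + x) = h * g (t *: v + (s *: u + x)).
  apply: (@MVT_line (fun y => 'D_u f y) (s *: u + x) v h h0) => t th.
  by apply: dDu; rewrite addrCA; apply: inO.
have -> : f (h *: u + (h *: v + x)) - f (h *: u + x) - f (h *: v + x) + f x =
    h ^+ 2 * g (t *: v + (s *: u + x)).
  transitivity (F (h *: u + x) - F x).
    rewrite /F opprB -[h *: u + x + _]addrA [x + h *: v]addrC.
    by rewrite -!addrA; congr (_ + (_ + _)); rewrite addrC.
  by rewrite Fs [s *: u + x + _]addrC Gt mulrA.
rewrite -mulrBr normrM ger0_norm ?sqr_ge0 // mulrC ler_wpM2r ?sqr_ge0 //.
have [_ /=] := rO _ (inb s t sh th).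
have -> : s *: u + (t *: v + x) = t *: v + (s *: u + x) by rewrite addrCA.
move: (g (t *: v + (s *: u + x))) => y.
by rewrite distrC.
Qed.

(** The second difference is symmetric in u and v, so both iterated
    derivatives are approximated by the same quantity. *)
Lemma schwarz_scalar (f : V -> R) (O : set V) x u v : open O -> O x ->
  Ck 2 O f -> 'D_v (fun y => 'D_u f y) x = 'D_u (fun y => 'D_v f y) x.
Proof.
move=> oO Ox Cf; set a := LHS; set b := RHS.
apply/eqP; rewrite -subr_eq0 -normr_le0; apply/ler_addgt0Pl => e e0.
have e2 : 0 < e / 2 by rewrite divr_gt0.
have [d1 d10 H1] := second_difference u v oO Ox Cf e2.
have [d2 d20 H2] := second_difference v u oO Ox Cf e2.
pose h := Num.min d1 d2 / 2.
have m0 : 0 < Num.min d1 d2 by rewrite lt_min d10.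
have h0 : 0 < h by rewrite divr_gt0.
have hm : h < Num.min d1 d2 by rewrite ltr_pdivrMr // mulr_natr mulr2n ltrDl.
move: hm; rewrite lt_min => /andP[h1 h2].
have := H1 h; rewrite h0 h1 => /(_ isT); have := H2 h; rewrite h0 h2 => /(_ isT).
rewrite -/a -/b [h *: v + (h *: u + x)]addrCA.
rewrite [_ - f (h *: v + x) - _]addrAC.
set D := _ + f x => B2 B1; rewrite addr0.
rewrite -(ler_pM2r (_ : 0 < h ^+ 2)) ?exprn_gt0 //.
rewrite -[h ^+ 2 in leLHS]ger0_norm ?sqr_ge0 // -normrM mulrBl.
have -> : a * h ^+ 2 - b * h ^+ 2 = (D - h ^+ 2 * b) - (D - h ^+ 2 * a) by ring.
apply: (le_trans (ler_normB _ _)); apply: (le_trans (lerD B2 B1)).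
by rewrite -mulrDl -splitr.
Qed.

Lemma schwarz n (f : V -> 'rV[R]_n) (O : set V) x u v : open O -> O x ->
  Ck 2 O f -> 'D_v (fun y => 'D_u f y) x = 'D_u (fun y => 'D_v f y) x.
Proof.
move=> oO Ox Cf; apply/rowP => i; have [df Df] := Cf.
have H w w' : ('D_w (fun y => 'D_w' f y) x) ord0 i =
    'D_w (fun y => 'D_w' (fun z => f z ord0 i) y) x.
  rewrite derive_coord; last by have [dDw _] := Df w'; exact: dDw.
  apply: near_eq_derive; apply: filterS (open_nbhs_nbhs (conj oO Ox)) => y Oy.
  by rewrite derive_coord //; exact: df.
have Ci : Ck 2 O (fun z => f z ord0 i) by exact: (@Ck_entry R V n 2 O f i oO Cf).
have S := @schwarz_scalar (fun z => f z ord0 i) O x u v oO Ox Ci.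
exact: (etrans (H v u) (etrans S (esym (H u v)))).
Qed.

End Schwarz.

(** * Derivatives along vector fields *)

Section Fields.
Context {R : realType} {n : nat}.
Local Notation V := 'rV[R]_n.

Lemma derive_along_scalar (f : V -> R) (X : V -> V) (O : set V) x w :
  open O -> O x -> Ck 2 O f -> differentiable X x ->
  differentiable (fun y => 'D_(X y) f y) x /\
  'D_w (fun y => 'D_(X y) f y) x =
  'D_w (fun y => 'D_(X x) f y) x + 'D_('D_w X x) f x.
Proof.
move=> oO Ox [df Df] dX.
pose g i y := 'D_(ebase i) f y.
have dg i : differentiable (g i) x by have [dDi _] := Df (ebase i); exact: dDi.
have E y u : O y -> 'D_u f y = \sum_i u ord0 i * g i y.
  move=> Oy; have L := derive_linear (df y Oy).
  rewrite {1}(row_sum_ebase u) (lin_sum _ _ L).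
  by apply: eq_bigr => i _; rewrite (linZ L).
have nO := open_nbhs_nbhs (conj oO Ox).
have dXi i : differentiable (fun y => X y ord0 i) x by exact: differentiable_entry.
pose t i y := X y ord0 i * g i y.
have dt i : differentiable (t i) x by exact: (differentiableM (dXi i) (dg i)).
have hE : \near x, (\sum_i t i) x = 'D_(X x) f x.
  by apply: filterS nO => y Oy; rewrite E // fct_sumE.
split.
  apply: near_eq_differentiable hE _.
  exact: (@differentiable_sum _ _ _ n t).
rewrite -(near_eq_derive w hE) derive_sum; last by move=> i; exact: diff_derivable.
rewrite (E x ('D_w X x)) //.
pose c i y := X x ord0 i * g i y.
have dc i : differentiable (c i) x.
  exact: (differentiableM (differentiable_cst _ _) (dg i)).
have -> : 'D_w (fun y => 'D_(X x) f y) x = \sum_i X x ord0 i * 'D_w (g i) x.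
  transitivity ('D_w (\sum_i c i) x).
    by apply: near_eq_derive; apply: filterS nO => y Oy; rewrite E // fct_sumE.
  rewrite derive_sum; last by move=> i; exact: diff_derivable.
  apply: eq_bigr => i _; have -> : c i = X x ord0 i \*o g i by [].
  by rewrite (deriveMl _ (diff_derivable (dg i))).
rewrite -big_split; apply: eq_bigr => i _.
rewrite [LHS](deriveM (diff_derivable (dXi i)) (diff_derivable (dg i))).
congr (_ + _); rewrite derive_coord //; exact: mulrC.
Qed.

(** The Leibniz rule for y |-> D_(X y) f y: differentiate the derivative of f
    in the frozen direction X x, then the direction itself. *)
Lemma derive_along m (f : V -> 'rV[R]_m) (X : V -> V) (O : set V) x w :
  open O -> O x -> Ck 2 O f -> differentiable X x ->
  differentiable (fun y => 'D_(X y) f y) x /\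
  'D_w (fun y => 'D_(X y) f y) x =
  'D_w (fun y => 'D_(X x) f y) x + 'D_('D_w X x) f x.
Proof.
move=> oO Ox Cf dX; have [df Df] := Cf.
have nO := open_nbhs_nbhs (conj oO Ox).
have H i := derive_along_scalar w oO Ox (Ck_entry i oO Cf) dX.
have d1 : differentiable (fun y => 'D_(X y) f y) x.
  apply: differentiable_rowP => i; apply: near_eq_differentiable (H i).1.
  by apply: filterS nO => y Oy; rewrite derive_coord //; exact: df.
split=> //; apply/rowP => i; rewrite mxE.
have dD u : differentiable (fun y => 'D_u f y) x by have [dDw _] := Df u; exact: dDw.
have near1 (Y : V -> V) : \near x, ('D_(Y x) f x) ord0 i = 'D_(Y x) (fun y => f y ord0 i) x.
  by apply: filterS nO => y Oy; exact: (derive_coord _ _ (df y Oy)).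
have e1 := derive_coord w i d1; have e2 := derive_coord w i (dD (X x)).
have e3 := derive_coord ('D_w X x) i (df x Ox).
apply: (etrans e1); apply: (etrans (near_eq_derive w (near1 X))).
apply: (etrans (H i).2); apply: (congr2 +%R _ (esym e3)).
exact: (esym (etrans e2 (near_eq_derive w (near1 (fun=> X x))))).
Qed.

End Fields.

(** * Brackets of vector fields *)

Section Brackets.
Context {R : realType} {n : nat}.
Local Notation V := 'rV[R]_n.

Definition vbracket (X Y : V -> V) (x : V) : V := 'D_(X x) Y x - 'D_(Y x) X x.

Lemma derive_related (F : V -> V) (X Y Y' : V -> V) (O : set V) x :
  open O -> O x -> Ck 2 O F -> differentiable Y x -> differentiable Y' (F x) ->
  (forall y, O y -> Y' (F y) = 'D_(Y y) F y) ->
  'D_('D_(X x) F x) Y' (F x) =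
  'D_(X x) (fun y => 'D_(Y x) F y) x + 'D_('D_(X x) Y x) F x.
Proof.
move=> oO Ox CF dY dY' YY'; have [dF _] := CF.
have e1 := derive_comp (X x) (dF x Ox) dY'.
have e2 : \near x, (Y' \o F) x = 'D_(Y x) F x.
  by apply: filterS (open_nbhs_nbhs (conj oO Ox)) => y Oy; exact: YY'.
have e3 := (derive_along (X x) oO Ox CF dY).2.
exact: (etrans (esym e1) (etrans (near_eq_derive (X x) e2) e3)).
Qed.

(** The second-order terms of F that appear in D_X (Y' o F) and D_Y (X' o F)
    are equal by the symmetry of second derivatives. *)
Lemma vbracket_related (F : V -> V) (X Y X' Y' : V -> V) (O : set V) x :
  open O -> O x -> Ck 2 O F -> differentiable X x -> differentiable Y x ->
  differentiable X' (F x) -> differentiable Y' (F x) ->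
  (forall y, O y -> X' (F y) = 'D_(X y) F y) ->
  (forall y, O y -> Y' (F y) = 'D_(Y y) F y) ->
  vbracket X' Y' (F x) = 'D_(vbracket X Y x) F x.
Proof.
move=> oO Ox CF dX dY dX' dY' XX' YY'; have [dF _] := CF.
have e1 := derive_related X oO Ox CF dY dY' YY'.
have e2 := derive_related Y oO Ox CF dX dX' XX'.
have S := schwarz (X x) (Y x) oO Ox CF.
have L := linB (derive_linear (dF x Ox)) ('D_(X x) Y x) ('D_(Y x) X x).
have e0 := congr2 (fun a b => 'D_a Y' (F x) - 'D_b X' (F x)) (XX' x Ox) (YY' x Ox).
have alg (a b s t p q : V) : a = s + p -> b = t + q -> t = s -> a - b = p - q.
  by move=> -> -> ->; rewrite opprD addrACA subrr add0r.
exact: (etrans e0 (etrans (alg _ _ _ _ _ _ e1 e2 S) (esym L))).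
Qed.

Lemma derive_vbracket (Y Z : V -> V) (O : set V) x w : open O -> O x ->
  Ck 2 O Y -> Ck 2 O Z ->
  'D_w (vbracket Y Z) x =
  ('D_w (fun y => 'D_(Y x) Z y) x + 'D_('D_w Y x) Z x) -
  ('D_w (fun y => 'D_(Z x) Y y) x + 'D_('D_w Z x) Y x).
Proof.
move=> oO Ox CY CZ; have [dY _] := CY; have [dZ _] := CZ.
have [d1 e1] := derive_along w oO Ox CZ (dY x Ox).
have [d2 e2] := derive_along w oO Ox CY (dZ x Ox).
have e := deriveB (diff_derivable (v := w) d1) (diff_derivable (v := w) d2).
exact: (etrans e (congr2 (fun a b => a - b) e1 e2)).
Qed.

Lemma vbracket_jacobi (X Y Z : V -> V) (O : set V) x : open O -> O x ->
  Ck 2 O X -> Ck 2 O Y -> Ck 2 O Z ->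
  vbracket X (vbracket Y Z) x =
  vbracket (vbracket X Y) Z x + vbracket Y (vbracket X Z) x.
Proof.
move=> oO Ox CX CY CZ; have [dX _] := CX; have [dY _] := CY; have [dZ _] := CZ.
have LX := linB (derive_linear (dX x Ox)).
have LY := linB (derive_linear (dY x Ox)).
have LZ := linB (derive_linear (dZ x Ox)).
have E1 := derive_vbracket (X x) oO Ox CY CZ.
have E2 := derive_vbracket (Z x) oO Ox CX CY.
have E3 := derive_vbracket (Y x) oO Ox CX CZ.
have S1 := schwarz (X x) (Y x) oO Ox CZ.
have S2 := schwarz (X x) (Z x) oO Ox CY.
have S3 := schwarz (Y x) (Z x) oO Ox CX.
have F1 := LX ('D_(Y x) Z x) ('D_(Z x) Y x).
have F2 := LZ ('D_(X x) Y x) ('D_(Y x) X x).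
have F3 := LY ('D_(X x) Z x) ('D_(Z x) X x).
have alg (A B C C' D D' xyz yxz xzy zxy yzx zyx a1 a2 b1 b2 c1 d1 : V) :
    A = (xyz + a1) - (xzy + a2) -> B = b1 - b2 -> C = a1 - c1 ->
    C' = (zxy + d1) - (zyx + b2) -> D = (yxz + c1) - (yzx + b1) -> D' = a2 - d1 ->
    yxz = xyz -> zxy = xzy -> zyx = yzx -> A - B = (C - C') + (D - D').
  by do 9 move=> ->; apply/rowP => i; rewrite !mxE; ring.
exact: (alg _ _ _ _ _ _ _ _ _ _ _ _ _ _ _ _ _ _ E1 F1 F2 E2 E3 F3 S1 S2 S3).
Qed.

(** The mean value theorem on the segment from p to y, for each coordinate. *)
Lemma derive0_constant m (F : V -> 'rV[R]_m) p (r : R) :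
  (forall y, ball p r y -> differentiable F y /\ forall v, 'D_v F y = 0) ->
  forall y, ball p r y -> F y = F p.
Proof.
move=> dF y py; apply/rowP => i.
have bl s : 0 <= s <= 1 -> ball p r (s *: (y - p) + p).
  move=> /andP[s0 s1]; move: py; rewrite -!ball_normE /ball_ /= => py.
  rewrite opprD addrCA subrr addr0 normrN normrZ ger0_norm //.
  apply: le_lt_trans py; rewrite distrC -[leRHS]mul1r.
  by rewrite ler_wpM2r.
have dFi s : 0 <= s <= 1 -> differentiable (fun z => F z ord0 i) (s *: (y - p) + p).
  by move=> sh; apply: differentiable_entry; have [] := dF _ (bl s sh).
have [s sh Fs] := MVT_line ltr01 dFi.
have [dFs Ds] := dF _ (bl s sh).
have e := derive_coord (y - p) i dFs.
move: Fs; rewrite -e Ds mxE mulr0 scale1r subrK => /eqP.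
by rewrite subr_eq0 => /eqP.
Qed.

Lemma Ck_det (W : normedModType R) m k (O : set W) (M : W -> 'M[R]_m) : open O ->
  (forall i j, Ck k O (fun x => M x i j)) -> Ck k O (fun x => \det (M x)).
Proof.
move=> oO CM; apply: Ck_sum => // s.
by apply: (Ck_mul oO); [exact: Ck_cst|exact: Ck_prod].
Qed.

(** Cramer's rule. *)
Lemma Ck_invmx (W : normedModType R) m k (O : set W) (M : W -> 'M[R]_m) : open O ->
  (forall x, O x -> M x \in unitmx) -> (forall i j, Ck k O (fun x => M x i j)) ->
  forall i j, Ck k O (fun x => invmx (M x) i j).
Proof.
move=> oO uM CM i j.
have d0 x : O x -> \det (M x) != 0 by move=> /uM; rewrite unitmxE unitfE.
have Cc : Ck k O (fun x => cofactor (M x) j i).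
  apply: (Ck_mul oO); first exact: Ck_cst.
  apply: Ck_det => // a b; have := CM (lift j a) (lift i b).
  by apply: Ck_ext => // x _; rewrite !mxE.
have := Ck_mul oO (Ck_inv oO d0 (Ck_det oO CM)) Cc.
by apply: Ck_ext => // x Ox; rewrite /invmx uM // !mxE.
Qed.

End Brackets.

(** * Left-invariant vector fields on a Lie group *)

Section Charts.
Context {R : realType} {n : nat} {M : topologicalType}.
Implicit Types (c : chart R n M).

Lemma cimg_cmap c p : cdom c p -> cimg c (cmap c p).
Proof. by move=> cp; exists p. Qed.

Lemma cdom_cinv c x : cimg c x -> cdom c (cinv c x).
Proof. by move=> [p cp <-]; rewrite cmapK. Qed.

Lemma cinvK c x : cimg c x -> cmap c (cinv c x) = x.
Proof. by move=> [p cp <-]; rewrite cmapK. Qed.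

Lemma open_cimg c : open (cimg c). Proof. exact: cimg_open. Qed.

Lemma cinv_cont c x : cimg c x -> {for x, continuous (cinv c)}.
Proof.
move=> cx; have := @cinv_continuous _ _ _ c.
rewrite continuous_open_subspace; last exact: cimg_open.
by apply; rewrite inE.
Qed.

Lemma cmap_cont c p : cdom c p -> {for p, continuous (cmap c)}.
Proof.
move=> cp; have := @cmap_continuous _ _ _ c.
rewrite continuous_open_subspace; last exact: cdom_open.
by apply; rewrite inE.
Qed.

Lemma open_preimage (T U : topologicalType) (O : set T) (D : set U) (f : T -> U) :
  open O -> open D -> (forall x, O x -> {for x, continuous f}) ->
  open (O `&` f @^-1` D).
Proof.
move=> oO oD cf; have /(continuous_inP f oO) H : {in O, continuous f}.
  by move=> x; rewrite inE; exact: cf.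
exact: H.
Qed.

End Charts.

(** Right-nested brackets, convenient in the algebra, against the left-nested
    ones of the lower central series. *)
Lemma foldr_antisymmetric (R : realFieldType) (V : lmodType R) (f : V -> V -> V) :
  (forall z, linear (f^~ z)) -> (forall x y, f x y = - f y x) ->
  forall u s, foldr f u s = (-1) ^+ size s *: foldl f u (rev s).
Proof.
move=> fL fA u s; rewrite foldl_rev; elim: s => [|v t IH]; first by rewrite scale1r.
by rewrite /= IH fA (linZ (@fL v)) exprS mulN1r scaleNr.
Qed.

Section LieGroup.
Context {R : realType} {n : nat} {G : topGroupType}.
Variable A : set (chart R n G).
Hypothesis lieG : lie_group A.
Local Notation V := 'rV[R]_n.
Implicit Types (a b c d : chart R n G).

Let mul_cont : continuous (fun p : G * G => (p.1 * p.2)%g).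
Proof. by have [_ [+ _] _] := lieG. Qed.

Lemma atlas_chart g : exists2 a, A a & cdom a g.
Proof. by have [[_ _ [+ _]] _ _] := lieG; exact. Qed.

Lemma lmul_cont g : continuous (fun h : G => (g * h)%g).
Proof.
move=> h; apply: (@continuous_comp _ _ _ (fun h : G => (g, h)) (fun p : G * G => (p.1 * p.2)%g)).
  by apply: cvg_pair; [exact: cvg_cst|exact: cvg_id].
exact: mul_cont.
Qed.

Lemma rmul_cont g : continuous (fun h : G => (h * g)%g).
Proof.
move=> h; apply: (@continuous_comp _ _ _ (fun h : G => (h, g)) (fun p : G * G => (p.1 * p.2)%g)).
  by apply: cvg_pair; [exact: cvg_id|exact: cvg_cst].
exact: mul_cont.
Qed.

(** The group law read in the charts a, b at the source and c at the target. *)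
Definition chart_mul a b c (xy : V * V) : V := cmap c (cinv a xy.1 * cinv b xy.2)%g.

Definition chart_mul_dom a b c : set (V * V) :=
  (cimg a `*` cimg b) `&` (fun xy => (cinv a xy.1 * cinv b xy.2)%g) @^-1` cdom c.

Lemma open_chart_mul_dom a b c : open (chart_mul_dom a b c).
Proof.
apply: open_preimage; [|exact: cdom_open|].
  by apply: openI; apply: open_comp; try exact: open_cimg;
    move=> x _; [exact: cvg_fst|exact: cvg_snd].
move=> [x y] [/= ax by_].
apply: (@continuous_comp _ _ _ (fun xy : V * V => (cinv a xy.1, cinv b xy.2))
  (fun p : G * G => (p.1 * p.2)%g)); last exact: mul_cont.
apply: cvg_pair.
  by apply: (@continuous_comp _ _ _ fst (cinv a)); [exact: cvg_fst|exact: cinv_cont].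
by apply: (@continuous_comp _ _ _ snd (cinv b)); [exact: cvg_snd|exact: cinv_cont].
Qed.

Lemma smooth_chart_mul a b c : A a -> A b -> A c -> smooth_on (chart_mul_dom a b c) (chart_mul a b c).
Proof.
move=> Aa Ab Ac k; have [_ [_ sm] _] := lieG.
apply: Ck_subset (sm a b c Aa Ab Ac k) => -[x y] [[/= ax by_] cxy].
exists (cinv a x), (cinv b y).
by split=> //; [exact: cdom_cinv|exact: cdom_cinv|rewrite !cinvK].
Qed.

Lemma smooth_slice_r (W W1 W2 : normedModType R) (f : W1 * W2 -> W) O p :
  smooth_on O f -> smooth_on [set y | O (p, y)] (fun y => f (p, y)).
Proof.
move=> sf k; apply: (@Ck_affine _ _ _ _ k O (fun y => (p, y)) (fun v => (0, v)) f _ _ (sf k)).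
  by move=> x; apply: differentiable_pair => //; exact: differentiable_cst.
by move=> x v h; congr pair; rewrite /= scaler0 add0r.
Qed.

Lemma smooth_slice_l (W W1 W2 : normedModType R) (f : W1 * W2 -> W) O p :
  smooth_on O f -> smooth_on [set y | O (y, p)] (fun y => f (y, p)).
Proof.
move=> sf k; apply: (@Ck_affine _ _ _ _ k O (fun y => (y, p)) (fun v => (v, 0)) f _ _ (sf k)).
  by move=> x; apply: differentiable_pair => //; exact: differentiable_cst.
by move=> x v h; congr pair; rewrite /= scaler0 add0r.
Qed.

(** Left and right ([rtr]) translation by g, read in charts. *)
Definition ltr g b c (y : V) : V := cmap c (g * cinv b y)%g.
Definition ltrdom g b c : set V :=
  cimg b `&` (fun y => (g * cinv b y)%g) @^-1` cdom c.
Definition rtr g b c (y : V) : V := cmap c (cinv b y * g)%g.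
Definition rtrdom g b c : set V :=
  cimg b `&` (fun y => (cinv b y * g)%g) @^-1` cdom c.

Lemma open_ltrdom g b c : open (ltrdom g b c).
Proof.
apply: open_preimage; [exact: open_cimg|exact: cdom_open|].
move=> y by_; apply: (@continuous_comp _ _ _ (cinv b) (fun h : G => (g * h)%g)).
  exact: cinv_cont.
exact: lmul_cont.
Qed.

Lemma open_rtrdom g b c : open (rtrdom g b c).
Proof.
apply: open_preimage; [exact: open_cimg|exact: cdom_open|].
move=> y by_; apply: (@continuous_comp _ _ _ (cinv b) (fun h : G => (h * g)%g)).
  exact: cinv_cont.
exact: rmul_cont.
Qed.

Lemma smooth_ltr g b c : A b -> A c -> smooth_on (ltrdom g b c) (ltr g b c).
Proof.
move=> Ab Ac; have [d Ad dg] := atlas_chart g; move=> k.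
have := smooth_slice_r (cmap d g) (smooth_chart_mul Ad Ab Ac) k.
have -> : (fun y => chart_mul d b c (cmap d g, y)) = ltr g b c.
  by apply/funext => y; rewrite /chart_mul /= cmapK.
apply: Ck_subset => y [by_ cy]; split=> /=; last by rewrite cmapK.
by split=> //; exact: cimg_cmap.
Qed.

Lemma smooth_rtr g b c : A b -> A c -> smooth_on (rtrdom g b c) (rtr g b c).
Proof.
move=> Ab Ac; have [d Ad dg] := atlas_chart g; move=> k.
have := smooth_slice_l (cmap d g) (smooth_chart_mul Ab Ad Ac) k.
have -> : (fun y => chart_mul b d c (y, cmap d g)) = rtr g b c.
  by apply/funext => y; rewrite /chart_mul /= cmapK.
apply: Ck_subset => y [by_ cy]; split=> /=; last by rewrite cmapK.
by split=> //; exact: cimg_cmap.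
Qed.

Lemma local_domE g b c : local_dom setT (ltrans g) b c = ltrdom g b c.
Proof.
apply/seteqP; split=> [x [p [bp _ cp] <-]|x [bx cx]].
  by split; [exact: cimg_cmap|rewrite /preimage /= cmapK].
exists (cinv b x); last exact: cinvK.
by split=> //; exact: cdom_cinv.
Qed.

Lemma local_repE g b c : local_rep (ltrans g) b c = ltr g b c.
Proof. by []. Qed.

Variable a : chart R n G.
Hypotheses (Aa : A a) (a1 : cdom a 1%g).
Local Notation x0 := (cmap a 1%g).

(** The value at x = p of the left-invariant field equal to u at 1 is the
    derivative along u, at y = 1, of the product p y. *)
Definition lfield (u : V) : vfield R n G :=
  fun b x => 'D_((0, u) : V * V) (chart_mul b a b) (x, x0).

Lemma lfieldE u b x : lfield u b x = 'D_u (ltr (cinv b x) a b) x0.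
Proof.
symmetry.
apply: (@derive_affine R _ _ _ (fun y => (x, y)) (fun v => (0, v)) (chart_mul b a b)) => h.
by congr pair; rewrite /= scaler0 add0r.
Qed.

Let cinv0 : cinv a x0 = 1%g. Proof. exact: cmapK. Qed.
Let ax0 : cimg a x0. Proof. exact: cimg_cmap. Qed.

Lemma chart_mul_dom_x0 b x : cimg b x -> chart_mul_dom b a b (x, x0).
Proof.
move=> bx; split=> //=; rewrite /preimage /= cinv0 mulg1; exact: cdom_cinv.
Qed.

Lemma ltrdom_x0 b x : cimg b x -> ltrdom (cinv b x) a b x0.
Proof. by move=> /chart_mul_dom_x0 [[]]. Qed.

Lemma ltr_x0 b x : cimg b x -> ltr (cinv b x) a b x0 = x.
Proof. by move=> bx; rewrite /ltr cinv0 mulg1 cinvK. Qed.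

Lemma smooth_lfield u b : A b -> smooth_on (cimg b) (lfield u b).
Proof.
move=> Ab k; have := smooth_slice_l x0 (smooth_derive ((0, u) : V * V) (smooth_chart_mul Ab Aa Ab)) k.
by apply: Ck_subset => x; exact: chart_mul_dom_x0.
Qed.

Lemma lfield_linear b x : A b -> cimg b x -> linear (fun u => lfield u b x).
Proof.
move=> Ab bx k u v; rewrite !lfieldE.
have dl := smooth_differentiable (smooth_ltr _ Aa Ab) (ltrdom_x0 bx).
exact: derive_linear.
Qed.

(** Differentiate (g p) y = g (p y) at y = 1. *)
Lemma lfield_related u g b c x : A b -> A c -> ltrdom g b c x ->
  lfield u c (ltr g b c x) = 'D_(lfield u b x) (ltr g b c) x.
Proof.
move=> Ab Ac gx; have [bx cx] := gx.
have d1 := smooth_differentiable (smooth_ltr _ Aa Ab) (ltrdom_x0 bx).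
have d2 : differentiable (ltr g b c) (ltr (cinv b x) a b x0).
  by rewrite ltr_x0 //; exact: smooth_differentiable (smooth_ltr _ Ab Ac) gx.
have e := derive_comp u d1 d2.
have e1 := lfieldE u c (ltr g b c x).
have e2 : \forall y \near x0,
    ltr (cinv c (ltr g b c x)) a c y = (ltr g b c \o ltr (cinv b x) a b) y.
  have nO : nbhs x0 (ltrdom (cinv b x) a b).
    by apply: open_nbhs_nbhs; split; [exact: open_ltrdom|exact: ltrdom_x0].
  apply: filterS nO.
  move=> y [yin yout]; rewrite /ltr /= [cinv c _]cmapK // [cinv b (cmap _ _)]cmapK //.
  by rewrite mulgA.
apply: (etrans e1); apply: (etrans (near_eq_derive u e2)); apply: (etrans e).
exact: (congr2 (fun w y => 'D_w (ltr g b c) y) (esym (lfieldE u b x)) (ltr_x0 bx)).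
Qed.

Lemma lfield_x0 u : lfield u a x0 = u.
Proof.
have e := lfieldE u a x0.
have e1 : \forall y \near x0, ltr (cinv a x0) a a y = id y.
  have nO : nbhs x0 (cimg a) by apply: open_nbhs_nbhs; split; [exact: open_cimg|].
  by apply: filterS nO => y ay; rewrite /ltr cinv0 mul1g cinvK.
exact: (etrans e (etrans (near_eq_derive u e1) (derive_id _ _))).
Qed.

Lemma left_invariant_lfieldE X b x : left_invariant_vf A X -> A b -> cimg b x ->
  X b x = lfield (X a x0) b x.
Proof.
move=> [_ lX] Ab bx; have e := lX (cinv b x) a b Aa Ab x0.
have := e; rewrite local_domE => /(_ (ltrdom_x0 bx)) H.
exact: (etrans (congr1 (X b) (esym (ltr_x0 bx))) (etrans H (esym (lfieldE _ _ _)))).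
Qed.

Lemma lfield_left_invariant u : left_invariant_vf A (lfield u).
Proof.
have H g : vf_related A A (ltrans g) (lfield u) (lfield u).
  by move=> b c Ab Ac x; rewrite local_domE => gx; exact: lfield_related.
split=> //; split; first by move=> b; exact: smooth_lfield.
have <- : ltrans (1%g : G) = id by apply/funext => x; rewrite /ltrans mul1g.
exact: H.
Qed.

(** The Lie bracket of g, with g identified with R^n by the chart a at 1. *)
Definition brk (u v : V) : V := lie_bracket (lfield u) (lfield v) a x0.

Lemma differentiable_lfield u b x : A b -> cimg b x -> differentiable (lfield u b) x.
Proof. by move=> Ab; exact: (smooth_differentiable (smooth_lfield u Ab)). Qed.

(** Translation by the point of coordinates x relates the left-invariant
    fields to themselves and sends 1 to that point, so naturality of the bracket
    determines the bracket from its value at 1. *)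
Lemma lfield_bracket u v b x : A b -> cimg b x ->
  lie_bracket (lfield u) (lfield v) b x = lfield (brk u v) b x.
Proof.
move=> Ab bx; have Fx := ltr_x0 bx.
have dF w : differentiable (lfield w b) (ltr (cinv b x) a b x0).
  by rewrite Fx; exact: differentiable_lfield.
have oD : open (ltrdom (cinv b x) a b) by exact: open_ltrdom.
have := @vbracket_related R n (ltr (cinv b x) a b) (lfield u a) (lfield v a)
  (lfield u b) (lfield v b) (ltrdom (cinv b x) a b) x0 oD
  (ltrdom_x0 bx) (smooth_ltr _ Aa Ab 2) (differentiable_lfield u Aa ax0)
  (differentiable_lfield v Aa ax0) (dF u) (dF v)
  (fun y => @lfield_related u _ a b y Aa Ab) (fun y => @lfield_related v _ a b y Aa Ab).
rewrite Fx => e; exact: (etrans e (esym (lfieldE _ _ _))).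
Qed.

Lemma vbracket_near (X Y X' Y' : V -> V) x :
  (\near x, X x = X' x) -> (\near x, Y x = Y' x) -> vbracket X Y x = vbracket X' Y' x.
Proof.
move=> XX YY; have X0 : X x = X' x by exact: nbhs_singleton XX.
have Y0 : Y x = Y' x by exact: nbhs_singleton YY.
have e1 := near_eq_derive (X x) YY; have e2 := near_eq_derive (Y x) XX.
have e3 := congr2 (fun p q : V => p - q) e1 e2.
apply: (etrans e3).
exact: (congr2 (fun p q : V => 'D_p Y' x - 'D_q X' x) X0 Y0).
Qed.

Lemma near_cimg b x (P : V -> Prop) : cimg b x -> (forall y, cimg b y -> P y) ->
  \forall y \near x, P y.
Proof.
move=> bx HP; have nO : nbhs x (cimg b).
  by apply: open_nbhs_nbhs; split=> //; exact: open_cimg.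
exact: filterS nO.
Qed.

Lemma brkA u v : brk u v = - brk v u.
Proof. by rewrite /brk /lie_bracket opprB. Qed.

Lemma brkL z : linear (brk^~ z).
Proof.
move=> k u v.
have E : \forall y \near x0, lfield (k *: u + v) a y = (k *: lfield u a + lfield v a) y.
  by apply: (near_cimg ax0) => y ay; exact: lfield_linear.
have du := differentiable_lfield u Aa ax0; have dv := differentiable_lfield v Aa ax0.
have dz := differentiable_lfield z Aa ax0.
have e1 := near_eq_derive (lfield z a x0) E.
have e2 := deriveD (diff_derivable (v := lfield z a x0) (differentiableZ k du))
  (diff_derivable (v := lfield z a x0) dv).
have e3 := deriveZ k (diff_derivable (v := lfield z a x0) du).
have e4 := derive_linear dz k (lfield u a x0) (lfield v a x0).
have e0 : lfield (k *: u + v) a x0 = k *: lfield u a x0 + lfield v a x0.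
  by rewrite !lfield_x0.
have e5 := etrans (congr1 (fun w => 'D_w (lfield z a) x0) e0) e4.
have e6 := etrans e1 (etrans e2 (congr1 (fun w => w + _) e3)).
have e7 := congr2 (fun p q : V => p - q) e5 e6; apply: (etrans e7).
have alg (p q r s : V) : k *: p + q - (k *: r + s) = k *: (p - r) + (q - s).
  by rewrite scalerBr opprD addrACA.
exact: alg.
Qed.

(** By [lfield_bracket] an iterated bracket in g is an iterated bracket of
    vector fields. *)
Lemma brkJac u v w : brk u (brk v w) = brk (brk u v) w + brk v (brk u w).
Proof.
have nr p q : \forall y \near x0, lfield (brk p q) a y = vbracket (lfield p a) (lfield q a) y.
  by apply: (near_cimg ax0) => y ay; exact: (esym (lfield_bracket p q Aa ay)).
have n0 p : \forall y \near x0, lfield p a y = lfield p a y by exact: (near_cimg ax0).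
have e1 := vbracket_near (n0 u) (nr v w).
have e2 := vbracket_near (nr u v) (n0 w).
have e3 := vbracket_near (n0 v) (nr u w).
have J := vbracket_jacobi (@open_cimg _ _ _ a) ax0 (smooth_lfield u Aa 2)
  (smooth_lfield v Aa 2) (smooth_lfield w Aa 2).
exact: (etrans e1 (etrans J (esym (congr2 +%R e2 e3)))).
Qed.

(** Iterated brackets of left-invariant fields, evaluated at 1. *)
Lemma brk_nilpotent k s u : lcs_trivial A k -> size s = k -> foldr brk u s = 0.
Proof.
move=> lk.
pose Z t := foldl (fun X v => lie_bracket X (lfield v)) (lfield u) t.
have HZ t : iterated_bracket A (size t) (Z t) /\
    forall y, cimg a y -> Z t a y = lfield (foldl brk u t) a y.
  elim/last_ind: t => [|t v [IH1 IH2]]; first by split=> //; exact: lfield_left_invariant.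
  rewrite size_rcons /Z !foldl_rcons -/(Z t); split.
    by exists (Z t), (lfield v); split=> //; exact: lfield_left_invariant.
  move=> y ay; have e : lie_bracket (Z t) (lfield v) a y = lie_bracket (lfield (foldl brk u t)) (lfield v) a y.
    exact: (vbracket_near (near_cimg ay IH2) (near_cimg ay (fun y _ => erefl (lfield v a y)))).
  exact: (etrans e (lfield_bracket _ _ Aa ay)).
have H t : size t = k -> foldl brk u t = 0.
  move=> tk; have [H1 H2] := HZ t; rewrite tk in H1.
  by rewrite -[LHS]lfield_x0 -H2 //; exact: lk.
move=> sk; apply: (etrans (foldr_antisymmetric brkL brkA u s)).
by rewrite H ?size_rev // scaler0.
Qed.

(** A left-invariant field is [lfield u], with u its value at 1. *)
Lemma lcs_trivial1 : (forall u v, brk u v = 0) -> lcs_trivial A 1.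
Proof.
move=> br0 Z [X [Y [lX lY ->]]] b Ab x bx.
have n1 T : left_invariant_vf A T -> \forall y \near x, T b y = lfield (T a x0) b y.
  by move=> lT; apply: (near_cimg bx) => y; exact: left_invariant_lfieldE.
have e := vbracket_near (n1 X lX) (n1 Y lY).
apply: (etrans e); apply: (etrans (lfield_bracket _ _ Ab bx)); rewrite br0.
exact: (lin0 (lfield_linear Ab bx)).
Qed.

End LieGroup.

(** * Left-invariant generalized Kähler structures *)

Lemma derive_pairing (R : realType) (V : normedModType R) n (f g : V -> 'rV[R]_n) x v :
  differentiable f x -> differentiable g x ->
  'D_v (fun y => pairing (f y) (g y)) x = pairing ('D_v f x) (g x) + pairing (f x) ('D_v g x).
Proof.
move=> df dg; pose t i y := f y ord0 i * g y ord0 i.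
have dfi i := differentiable_entry i df; have dgi i := differentiable_entry i dg.
have dt i : differentiable (t i) x by exact: (differentiableM (dfi i) (dgi i)).
have -> : (fun y => pairing (f y) (g y)) = \sum_i t i.
  by apply/funext => y; rewrite fct_sumE.
have e := derive_sum (fun i => diff_derivable (v := v) (dt i)).
apply: (etrans e); rewrite /pairing -big_split; apply: eq_bigr => i _.
have e1 := deriveM (diff_derivable (v := v) (dfi i)) (diff_derivable (v := v) (dgi i)).
apply: (etrans e1); rewrite -(derive_coord v i df) -(derive_coord v i dg).
by rewrite addrC; congr (_ + _); rewrite mulrC.
Qed.

Lemma pairing_mulmx (R : realType) n (x y : 'rV[R]_n) (M : 'M[R]_n) :
  pairing x (y *m M) = pairing (x *m M^T) y.
Proof.
have E (u v : 'rV[R]_n) : pairing u v = (u *m v^T) ord0 ord0.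
  by rewrite mxE; apply: eq_bigr => i _; rewrite mxE.
by rewrite !E trmx_mul mulmxA.
Qed.

Section Frames.
Context {R : realType} {n : nat} {G : topGroupType}.
Variable A : set (chart R n G).
Hypothesis lieG : lie_group A.
Variable a : chart R n G.
Hypotheses (Aa : A a) (a1 : cdom a 1%g).
Local Notation V := 'rV[R]_n.
Local Notation x0 := (cmap a 1%g).
Local Notation lfield := (lfield a).
Local Notation brk := (brk a).

Let ax0 : cimg a x0. Proof. exact: cimg_cmap. Qed.
Let cinv0 : cinv a x0 = 1%g. Proof. exact: cmapK. Qed.

Definition frame (x : V) : 'M[R]_n := \matrix_(i, j) lfield (ebase i) a x ord0 j.

Lemma lfield_frame u x : cimg a x -> lfield u a x = u *m frame x.
Proof.
move=> ax; have L := lfield_linear lieG Aa a1 Aa ax.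
rewrite {1}(row_sum_ebase u) (lin_sum _ _ L); apply/rowP => j; rewrite !mxE summxE.
by apply: eq_bigr => i _; rewrite (linZ L) !mxE.
Qed.

(** Translation back to 1 sends the value of a left-invariant field at x to
    its value at 1, so the former determines the latter. *)
Lemma frame_unitmx x : cimg a x -> frame x \in unitmx.
Proof.
move=> ax; rewrite -row_free_unit -kermx_eq0; apply/rowV0P => u /sub_kermxP.
rewrite -lfield_frame // => u0.
(* Translation by g sends x to 1. *)
pose g := ((cinv a x)^-1)%g.
have gx : ltrdom g a a x by split=> //; rewrite /preimage /g /= mulVg.
have H := lfield_related lieG Aa a1 u Aa Aa gx.
have gx0 : ltr g a a x = x0 by rewrite /ltr /g mulVg.
have e1 := congr1 (fun w => 'D_w (ltr g a a) x) u0.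
have e2 := congr1 (lfield u a) gx0.
rewrite -(lfield_x0 a1 u).
exact: (etrans (esym e2) (etrans H (etrans e1 (derive0 _ _)))).
Qed.

(** The left-invariant 1-form with value al at 1, by [pairing_coframe]. *)
Definition coframe (al : V) (x : V) : V := al *m (invmx (frame x))^T.

Lemma pairing_coframe al u x : cimg a x -> pairing (coframe al x) (lfield u a x) = pairing al u.
Proof.
move=> ax; rewrite lfield_frame // pairing_mulmx /coframe -mulmxA -trmx_mul.
by rewrite mulmxV ?frame_unitmx // trmx1 mulmx1.
Qed.

Lemma coframe_unique al be x : cimg a x ->
  (forall w, pairing al w = pairing be (lfield w a x)) -> be = coframe al x.
Proof.
move=> ax H; apply: pairing_ext => w; have ux := frame_unitmx ax.
by rewrite -[w](mulmxKV ux) -lfield_frame // -H pairing_coframe.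
Qed.

Lemma frame_x0 : frame x0 = 1%:M.
Proof.
apply/matrixP => i j; rewrite mxE lfield_x0 // !mxE eqxx /=.
by rewrite eq_sym.
Qed.

Lemma coframe_x0 al : coframe al x0 = al.
Proof. by rewrite /coframe frame_x0 invmx1 trmx1 mulmx1. Qed.

Lemma smooth_coframe al : smooth_on (cimg a) (coframe al).
Proof.
move=> k; apply: Ck_row => [|i]; first exact: open_cimg.
have oa : open (cimg a) by exact: open_cimg.
have CM i' j : Ck k (cimg a) (fun x => frame x i' j).
  have := Ck_entry j oa (smooth_lfield lieG Aa a1 (ebase i') Aa k).
  by apply: Ck_ext => // x _; rewrite mxE.
have Ci := Ck_invmx oa frame_unitmx CM.
have := Ck_sum (index_enum 'I_n) xpredT oa (fun j => Ck_mul oa (Ck_cst k (cimg a) (al ord0 j : R)) (Ci i j)).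
by apply: Ck_ext => // x _; rewrite mxE; apply: eq_bigr => j _; rewrite mxE.
Qed.

(** The left-invariant section of TG (+) T*G with value u at 1. *)
Definition linv_section (u : gvec R n) (x : V) : gvec R n := (lfield u.1 a x, coframe u.2 x).

Lemma smooth_linv_section u : smooth_on (cimg a) (linv_section u).
Proof.
move=> k; apply: Ck_pair; first exact: open_cimg.
- exact: (smooth_lfield lieG Aa a1 u.1 Aa k).
- exact: smooth_coframe.
Qed.

Lemma linv_sectionN u x : cimg a x -> linv_section (- u) x = - linv_section u x.
Proof.
move=> ax; congr pair; first exact: (linN (lfield_linear lieG Aa a1 Aa ax)).
by rewrite /coframe mulNmx.
Qed.

(** Translation from 1 to x carries u to the value at x of [linv_section u]. *)
Lemma left_invariant_gendoE (K : gendo R n G) : left_invariant_gendo A K ->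
  forall u x, cimg a x -> K a x (linv_section u x) = linv_section (K a x0 u) x.
Proof.
move=> lK u x ax; have := lK (cinv a x) a a Aa Aa x0.
rewrite local_domE => /(_ (ltrdom_x0 a1 ax)) H.
have E w : lfield w a x = 'D_w (local_rep (ltrans (cinv a x)) a a) x0.
  exact: lfieldE.
have [|] := H u (linv_section u x).
  split; first exact: E.
  by move=> w; rewrite -E pairing_coframe.
rewrite local_repE (ltr_x0 a1 ax) => H1 H2.
rewrite [LHS]surjective_pairing; congr pair; first exact: (etrans H1 (esym (E _))).
apply: (coframe_unique ax) => w.
exact: (etrans (H2 w) (congr1 (pairing (K a x (linv_section u x)).2) (esym (E w)))).
Qed.

Let near_pairing (p q : V) : \forall y \near x0, pairing (coframe q y) (lfield p a y) = pairing q p.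
Proof. by apply: (near_cimg ax0) => y ay; exact: pairing_coframe. Qed.

Let dco (al : V) : differentiable (coframe al) x0.
Proof. exact: (smooth_differentiable (smooth_coframe al)). Qed.
Let dlf (u : V) : differentiable (lfield u a) x0.
Proof. exact: (differentiable_lfield lieG Aa a1). Qed.

Let derive_coframe al u w :
  pairing ('D_u (coframe al) x0) w = - pairing al ('D_u (lfield w a) x0).
Proof.
have e := derive_pairing u (dco al) (dlf w).
have e1 := near_eq_derive u (near_pairing w al).
have e2 := derive_cst (pairing al w : R) x0 u.
have := etrans (esym e) (etrans e1 e2); rewrite lfield_x0 // coframe_x0.
by move=> /eqP; rewrite addr_eq0 => /eqP.
Qed.

(** The Maurer-Cartan equation at 1: differentiate the constant function
    pairing the form with a left-invariant field. *)
Lemma ext_d_coframe al u w : ext_d (coframe al) x0 u w = - pairing al (brk u w).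
Proof.
have e1 := derive_coframe al u w; have e2 := derive_coframe al w u.
have e3 : brk u w = 'D_u (lfield w a) x0 - 'D_w (lfield u a) x0.
  exact: (congr2 (fun p q : V => 'D_p (lfield w a) x0 - 'D_q (lfield u a) x0)
    (lfield_x0 a1 u) (lfield_x0 a1 w)).
apply: (etrans (congr2 (fun r s : R => r - s) e1 e2)).
by rewrite e3 pairingDr pairingNr opprD.
Qed.

Lemma courant_linv_section (p q : gvec R n) :
  courant (linv_section p) (linv_section q) x0 = courant_alg brk p q.
Proof.
have D0 : dfun (fun y => pairing (coframe q.2 y) (lfield p.1 a y) -
    pairing (coframe p.2 y) (lfield q.1 a y)) x0 = 0.
  apply/rowP => j; rewrite !mxE.
  have nr : \forall y \near x0, pairing (coframe q.2 y) (lfield p.1 a y) -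
    pairing (coframe p.2 y) (lfield q.1 a y) = cst (pairing q.2 p.1 - pairing p.2 q.1) y.
    by apply: (near_cimg ax0) => y ay; rewrite !pairing_coframe.
  exact: (etrans (near_eq_derive _ nr) (derive_cst _ _ _)).
congr pair; rewrite [X in _ + _ *: X]D0 scaler0 addr0.
apply/rowP => j; rewrite !mxE /= !(lfield_x0 a1) !ext_d_coframe.
by rewrite opprK addrC.
Qed.

(** The sections s_u - i s_(J u) lie in the +i eigenbundle; their Courant
    bracket at 1 is computed by [courant_linv_section]. *)
Lemma gc_integrable_alg (K : gendo R n G) : generalized_complex A K ->
  left_invariant_gendo A K -> let J := K a x0 in
  forall p q, J (courant_alg brk p q - courant_alg brk (J p) (J q)) =
              courant_alg brk p (J q) + courant_alg brk (J p) q.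
Proof.
move=> gK lK J p q; have H u x : cimg a x -> K a x (linv_section u x) = linv_section (J u) x.
  exact: left_invariant_gendoE.
have JL : linear J by exact: (gendo_linear (gc_endo gK)).
have JJ u : J (J u) = - u by exact: (gc_square gK).
have Z u x : cimg a x -> plus_i_eigen (K a x) (linv_section u x, linv_section (- J u) x).
  move=> ax; split=> /=; first by rewrite H // linv_sectionN // opprK.
  by rewrite H // (linN JL) JJ opprK.
have sZ u : smooth_on (cimg a) (fun x => (linv_section u x, linv_section (- J u) x)).
  by move=> k; apply: Ck_pair; [exact: open_cimg|exact: smooth_linv_section..].
have oa : open (cimg a) by exact: open_cimg.
have [] := gc_integrable gK Aa oa (@subset_refl _ _) (sZ p) (sZ q) (Z p) (Z q) ax0.
rewrite /ccourant /= -/J.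
rewrite !courant_linv_section.
have bL := brkL lieG Aa a1; have bA := @brkA R n G a.
have N1 := courant_algNl bL bA; have N2 := courant_algNr bL bA.
move: (courant_alg brk) N1 N2 => crt N1 N2.
rewrite !N1 !N2 !opprK => -> _.
by rewrite opprD !opprK.
Qed.

(** The values at 1 of the two structures satisfy the hypotheses of
    [gk_algebra_abelian]. *)
Lemma gk_brk_trivial (K1 K2 : gendo R n G) k : lcs_trivial A k ->
  generalized_kahler A K1 K2 ->
  left_invariant_gendo A K1 -> left_invariant_gendo A K2 ->
  forall u v, brk u v = 0.
Proof.
move=> nil gk l1 l2; have g1 := gk_gc1 gk; have g2 := gk_gc2 gk.
apply: (@gk_algebra_abelian R n brk (brkL lieG Aa a1) (@brkA R n G a)
  (brkJac lieG Aa a1) k _ (K1 a x0) (K2 a x0)).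
- by move=> s u sk; exact: (brk_nilpotent lieG Aa a1 _ nil sk).
- exact: (gendo_linear (gc_endo g1)).
- exact: (gendo_linear (gc_endo g2)).
- exact: (gc_square g1).
- exact: (gc_square g2).
- exact: (gc_orthogonal g1).
- exact: (gc_orthogonal g2).
- exact: gc_integrable_alg.
- exact: gc_integrable_alg.
- exact: (gk_commute gk).
- exact: (gk_positive gk).
Qed.

End Frames.

(** * Connected Lie groups with abelian Lie algebra *)

Lemma nbhs_preimage (T U : topologicalType) (f : T -> U) x y B :
  {for x, continuous f} -> f x = y -> nbhs y B -> nbhs x (f @^-1` B).
Proof. by move=> cf <-; exact: cf. Qed.

Section Abelian.
Context {R : realType} {n : nat} {G : topGroupType}.
Variable A : set (chart R n G).
Hypothesis lieG : lie_group A.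
Variable a : chart R n G.
Hypotheses (Aa : A a) (a1 : cdom a 1%g).
Local Notation V := 'rV[R]_n.
Local Notation x0 := (cmap a 1%g).
Local Notation lfield := (lfield a).
Local Notation brk := (brk a).
Local Notation frame := (frame a).
Local Notation coframe := (coframe a).
Local Notation m := (chart_mul a a a).
Local Notation W := (chart_mul_dom a a a).

Let ax0 : cimg a x0. Proof. exact: cimg_cmap. Qed.
Let cinv0 : cinv a x0 = 1%g. Proof. exact: cmapK. Qed.

(** The value at x = p of the right-invariant field equal to v at 1 is the
    derivative along v, at y = 1, of the product y p. *)
Definition rfield (v x : V) : V := 'D_((v, 0) : V * V) m (x0, x).

Let derive_slice_l (W' : normedModType R) (f : V * V -> W') v x y :
  'D_v (fun z => f (z, y)) x = 'D_((v, 0) : V * V) f (x, y).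
Proof.
apply: (@derive_affine R _ _ _ (fun z => (z, y)) (fun v => (v, 0)) f) => h.
by congr pair; rewrite /= scaler0 add0r.
Qed.

Let derive_slice_r (W' : normedModType R) (f : V * V -> W') v x y :
  'D_v (fun z => f (x, z)) y = 'D_((0, v) : V * V) f (x, y).
Proof.
apply: (@derive_affine R _ _ _ (fun z => (x, z)) (fun v => (0, v)) f) => h.
by congr pair; rewrite /= scaler0 add0r.
Qed.

Lemma rfieldE v x : rfield v x = 'D_v (rtr (cinv a x) a a) x0.
Proof. exact: (esym (derive_slice_l m v x0 x)). Qed.

Lemma chart_mul_dom_0x x : cimg a x -> W (x0, x).
Proof.
move=> ax; split=> //=; rewrite /preimage /= cinv0 mul1g; exact: cdom_cinv.
Qed.

Lemma rtrdom_x0 x : cimg a x -> rtrdom (cinv a x) a a x0.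
Proof. by move=> /chart_mul_dom_0x [[]]. Qed.

Lemma rtr_x0 x : cimg a x -> rtr (cinv a x) a a x0 = x.
Proof. by move=> ax; rewrite /rtr cinv0 mul1g cinvK. Qed.

Lemma rfield_related v g x : rtrdom g a a x ->
  rfield v (rtr g a a x) = 'D_(rfield v x) (rtr g a a) x.
Proof.
move=> gx; have [ax cx] := gx.
have d1 := smooth_differentiable (smooth_rtr lieG _ Aa Aa) (rtrdom_x0 ax).
have d2 : differentiable (rtr g a a) (rtr (cinv a x) a a x0).
  by rewrite rtr_x0 //; exact: smooth_differentiable (smooth_rtr lieG _ Aa Aa) gx.
have e := derive_comp v d1 d2.
have e2 : \forall y \near x0,
    rtr (cinv a (rtr g a a x)) a a y = (rtr g a a \o rtr (cinv a x) a a) y.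
  have nO : nbhs x0 (rtrdom (cinv a x) a a).
    by apply: open_nbhs_nbhs; split; [exact: (open_rtrdom lieG)|exact: rtrdom_x0].
  apply: filterS nO => y [yin yout].
  by rewrite /rtr /= [cinv a (cmap a (_ * g)%g)]cmapK // [cinv a (cmap _ _)]cmapK // mulgA.
apply: (etrans (rfieldE v _)); apply: (etrans (near_eq_derive v e2)); apply: (etrans e).
exact: (congr2 (fun w y => 'D_w (rtr g a a) y) (esym (rfieldE v x)) (rtr_x0 ax)).
Qed.

Lemma rfield_x0 v : rfield v x0 = v.
Proof.
have e1 : \forall y \near x0, rtr (cinv a x0) a a y = id y.
  by apply: (near_cimg ax0) => y ay; rewrite /rtr cinv0 mulg1 cinvK.
exact: (etrans (rfieldE v x0) (etrans (near_eq_derive v e1) (derive_id _ _))).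
Qed.

Lemma smooth_rfield v : smooth_on (cimg a) (rfield v).
Proof.
move=> k; have := smooth_slice_r x0 (smooth_derive ((v, 0) : V * V) (smooth_chart_mul lieG Aa Aa Aa)) k.
by apply: Ck_subset => x; exact: chart_mul_dom_0x.
Qed.

Let drf v x : cimg a x -> differentiable (rfield v) x.
Proof. exact: (smooth_differentiable (smooth_rfield v)). Qed.

(** Left and right multiplications commute: both sides are the mixed second
    derivative of the product (y, z) |-> y x z at y = z = 1, taken in the two
    possible orders. *)
Lemma vbracket_lfield_rfield u v x : cimg a x ->
  'D_(lfield u a x) (rfield v) x = 'D_(rfield v x) (lfield u a) x.
Proof.
move=> ax; set g := cinv a x; set w := rfield v x.
have gx0 : ltrdom g a a x0 by exact: ltrdom_x0.
have Lx : ltr g a a x0 = x by exact: ltr_x0.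
have d1 := smooth_differentiable (smooth_ltr lieG g Aa Aa) gx0.
have d2 : differentiable (rfield v) (ltr g a a x0) by rewrite Lx; exact: drf.
have e1 := derive_comp u d1 d2.
have e2 : \forall y \near x0, (rfield v \o ltr g a a) y = 'D_((w, 0) : V * V) m (x, y).
  have nO : nbhs x0 (ltrdom g a a).
    by apply: open_nbhs_nbhs; split; [exact: (open_ltrdom lieG)|].
  apply: filterS nO => y [ay gy].
  have ry : rtrdom (cinv a y) a a x by split.
  exact: (etrans (rfield_related v ry) (derive_slice_l m w x y)).
have e3 := derive_slice_r (fun z => 'D_((w, 0) : V * V) m z) u x x0.
have e4 := derive_slice_l (fun z => 'D_((0, u) : V * V) m z) w x x0.
have oW : open W by exact: (open_chart_mul_dom lieG).
have S := schwarz ((w, 0) : V * V) ((0, u) : V * V) oW (chart_mul_dom_x0 a1 ax)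
  (smooth_chart_mul lieG Aa Aa Aa 2).
have e0 := congr2 (fun p q => 'D_p (rfield v) q) (esym (lfieldE a u a x)) Lx.
apply: (etrans (esym e0)); apply: (etrans (esym e1)).
apply: (etrans (near_eq_derive u e2)); apply: (etrans e3).
exact: (etrans S (esym e4)).
Qed.

Lemma pairing_derive_coframe al z x w : cimg a x ->
  pairing ('D_w (coframe al) x) (lfield z a x) = - pairing (coframe al x) ('D_w (lfield z a) x).
Proof.
move=> ax.
have dc := smooth_differentiable (smooth_coframe lieG Aa a1 al) ax.
have dl := differentiable_lfield lieG Aa a1 z Aa ax.
have nr : \forall y \near x, pairing (coframe al y) (lfield z a y) = cst (pairing al z) y.
  by apply: (near_cimg ax) => y ay; exact: (pairing_coframe lieG).
have := etrans (esym (derive_pairing w dc dl)) (etrans (near_eq_derive w nr) (derive_cst _ _ _)).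
by move=> /eqP; rewrite addr_eq0 => /eqP.
Qed.

Hypothesis br0 : forall u v, brk u v = 0.

(** The left-invariant coefficients of a right-invariant field are constant:
    along a left-invariant field L_u, with L_z the left-invariant field that
    agrees with the right-invariant field at x, the derivative is
    - al [u, z] = 0. *)
Lemma derive_coframe_rfield al v x w : cimg a x ->
  'D_w (fun y => pairing (coframe al y) (rfield v y)) x = 0.
Proof.
move=> ax; have ux := frame_unitmx lieG Aa a1 ax.
pose u := w *m invmx (frame x); pose z := rfield v x *m invmx (frame x).
have wE : lfield u a x = w by rewrite (lfield_frame lieG) // mulmxKV.
have zE : lfield z a x = rfield v x by rewrite (lfield_frame lieG) // mulmxKV.
have dc := smooth_differentiable (smooth_coframe lieG Aa a1 al) ax.
have e1 := derive_pairing w dc (drf v ax).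
have e2 := congr1 (pairing ('D_w (coframe al) x)) (esym zE).
have e3 := pairing_derive_coframe al z w ax.
have e4 := vbracket_lfield_rfield u v ax.
have e5 := congr1 (fun q => 'D_q (rfield v) x) (esym wE).
have e6 := congr1 (fun q => 'D_q (lfield u a) x) (esym zE).
have e7 := lfield_bracket lieG Aa a1 u z Aa ax.
have e8 : lfield (brk u z) a x = 0.
  by rewrite br0; exact: (lin0 (lfield_linear lieG Aa a1 Aa ax)).
have e9 := congr1 (fun q => 'D_q (lfield z a) x) wE.
have e10 : 'D_w (rfield v) x = 'D_w (lfield z a) x.
  apply: (etrans e5); apply: (etrans e4); apply: (etrans e6); apply: esym.
  apply: (etrans (esym e9)); apply/subr0_eq; exact: (etrans e7 e8).
apply: (etrans e1); apply: (etrans (congr2 +%R (etrans e2 e3) (congr1 (pairing (coframe al x)) e10))).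
exact: addNr.
Qed.

(** Read in the left-invariant frame, a right-invariant field is constant on
    the ball. *)
Lemma rfield_lfield r : ball x0 r `<=` cimg a -> forall v x, ball x0 r x ->
  rfield v x = lfield v a x.
Proof.
move=> Br v x rx; have ax := Br x rx.
pose h y : V := \row_i pairing (coframe (ebase i) y) (rfield v y).
have dhi i y : cimg a y -> differentiable (fun y => pairing (coframe (ebase i) y) (rfield v y)) y.
  move=> ay; have dc := smooth_differentiable (smooth_coframe lieG Aa a1 (ebase i)) ay.
  have -> : (fun y => pairing (coframe (ebase i) y) (rfield v y)) =
     \sum_j (fun y => coframe (ebase i) y ord0 j * rfield v y ord0 j).
    by apply/funext => z; rewrite fct_sumE.
  apply: (@differentiable_sum _ _ _ n (fun j y => coframe (ebase i) y ord0 j * rfield v y ord0 j)) => j.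
  exact: (differentiableM (differentiable_entry j dc) (differentiable_entry j (drf v ay))).
have hE i : (fun y => h y ord0 i) = (fun y => pairing (coframe (ebase i) y) (rfield v y)).
  by apply/funext => y; rewrite mxE.
have dh y : cimg a y -> differentiable h y.
  by move=> ay; apply: differentiable_rowP => i; rewrite hE; exact: dhi.
have hc : h x = h x0.
  apply: (@derive0_constant R n n h x0 r) rx => y /Br ay; split; first exact: dh.
  move=> w; apply/rowP => i; rewrite mxE.
  apply: (etrans (derive_coord w i (dh y ay))).
  exact: (etrans (congr1 (fun f => 'D_w f y) (hE i)) (derive_coframe_rfield _ _ _ ay)).
have hM y : cimg a y -> h y = rfield v y *m invmx (frame y).
  move=> ay; apply/rowP => i; rewrite mxE -pairing_delta [RHS]pairingC.
  by rewrite pairing_mulmx.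
have h1 := etrans (esym (hM x ax)) (etrans hc (hM x0 ax0)).
have h2 : rfield v x0 *m invmx (frame x0) = v.
  by rewrite (rfield_x0 v) (frame_x0 a1) invmx1 mulmx1.
have h3 := congr1 (mulmx^~ (frame x)) (etrans h1 h2).
have ux := frame_unitmx lieG Aa a1 ax.
exact: (etrans (esym (mulmxKV ux (rfield v x))) (etrans h3 (esym (lfield_frame lieG Aa a1 v ax)))).
Qed.

Let mulG_cont : continuous (fun p : G * G => (p.1 * p.2)%g).
Proof. by have [_ [+ _] _] := lieG. Qed.

Let invG_cont : continuous (fun g : G => g^-1%g).
Proof. by have [_ _ [H _]] := lieG; exact/continuous_subspace_setT. Qed.

Definition chart_inv (x : V) : V := cmap a (cinv a x)^-1%g.

Lemma differentiable_chart_inv x : cimg a x -> cdom a (cinv a x)^-1%g -> differentiable chart_inv x.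
Proof.
move=> ax aix; have [_ _ [_ sm]] := lieG.
apply: (smooth_differentiable (sm a a Aa Aa)).
by exists (cinv a x); [split=> //; exact: cdom_cinv|exact: cinvK].
Qed.

(** Right translation by g^-1 is an inverse of right translation by g. *)
Lemma derive_rtr_inj g z w : rtrdom g a a z -> 'D_w (rtr g a a) z = 0 -> w = 0.
Proof.
move=> gz D0; have [az gz'] := gz.
have zg : rtrdom g^-1%g a a (rtr g a a z).
  split; first exact: cimg_cmap.
  by rewrite /preimage /= /rtr cmapK // mulgK; exact: cdom_cinv.
have d1 := smooth_differentiable (smooth_rtr lieG _ Aa Aa) gz.
have d2 := smooth_differentiable (smooth_rtr lieG _ Aa Aa) zg.
have e := derive_comp w d1 d2.
have e1 : \forall y \near z, (rtr g^-1%g a a \o rtr g a a) y = id y.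
  have nO : nbhs z (rtrdom g a a).
    by apply: open_nbhs_nbhs; split; [exact: (open_rtrdom lieG)|].
  apply: filterS nO => y [ay gy].
  by rewrite /rtr /= [cinv a (cmap a (cinv a y * g)%g)]cmapK // mulgK cinvK.
have e2 := etrans (near_eq_derive w e1) (derive_id _ _).
have e3 := congr1 (fun q => 'D_q (rtr g^-1%g a a) (rtr g a a z)) D0.
exact: (etrans (esym e2) (etrans e (etrans e3 (derive0 _ _)))).
Qed.

Section Conjugation.
Variables (r : R) (h : G) (O : set V).
Hypothesis Br : ball x0 r `<=` cimg a.
Hypotheses (oO : open O) (OB : O `<=` ball x0 r).
Hypothesis Oinv : forall y, O y -> cdom a (cinv a y)^-1%g.
Hypothesis Omul : forall y, O y ->
  cdom a (cinv a y * h)%g /\ ball x0 r (cmap a (cinv a y * h)%g).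
Hypothesis Oconj : forall y, O y -> cdom a (cinv a y * h * (cinv a y)^-1)%g.

Definition chart_conj (y : V) : V := m (rtr h a a y, chart_inv y).

Let chart_conjE y : O y -> chart_conj y = cmap a (cinv a y * h * (cinv a y)^-1)%g.
Proof.
move=> Oy; rewrite /chart_conj /chart_mul /rtr /chart_inv /= [cinv a (cmap a (_ * h)%g)]cmapK.
  by rewrite cmapK //; exact: Oinv.
by have [] := Omul Oy.
Qed.

Let rtrO y : O y -> rtrdom h a a y.
Proof. by move=> Oy; split; [exact/Br/OB|have [] := Omul Oy]. Qed.

Lemma differentiable_chart_conj y : O y -> differentiable chart_conj y.
Proof.
move=> Oy; have ay : cimg a y by exact/Br/OB.
have d1 := smooth_differentiable (smooth_rtr lieG h Aa Aa) (rtrO Oy).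
have d2 := differentiable_chart_inv ay (Oinv Oy).
have Wy : W (rtr h a a y, chart_inv y).
  have [mh _] := Omul Oy.
  split; first by split; apply: cimg_cmap => //; exact: Oinv.
  rewrite /preimage /= /rtr /chart_inv [cinv a (cmap a (_ * h)%g)]cmapK // cmapK; last exact: Oinv.
  exact: Oconj.
have dm := smooth_differentiable (smooth_chart_mul lieG Aa Aa Aa) Wy.
exact: (differentiable_comp (differentiable_pair d1 d2) dm).
Qed.

(** Differentiate (y h y^-1) y = y h along a vector w at y. As w is both a
    left- and a right-invariant value, moving the second factor of the left-hand
    side and moving y in the right-hand side contribute the same vector, and
    only the variation of y h y^-1 remains; right translation by y is
    injective on it. *)
Lemma derive_chart_conj y w : O y -> 'D_w chart_conj y = 0.
Proof.
move=> Oy; have ay : cimg a y by exact/Br/OB.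
have ux := frame_unitmx lieG Aa a1 ay.
pose u := w *m invmx (frame y).
have wE : lfield u a y = w.
  exact: (etrans (lfield_frame lieG Aa a1 u ay) (mulmxKV ux w)).
have [mh Bh] := Omul Oy.
have cF : cinv a (chart_conj y) = (cinv a y * h * (cinv a y)^-1)%g.
  by rewrite chart_conjE // cmapK //; exact: Oconj.
have aF : cimg a (chart_conj y) by rewrite chart_conjE //; exact/cimg_cmap/Oconj.
have WF : W (chart_conj y, y).
  by split=> //=; rewrite /preimage /= cF mulgVK.
have dm := smooth_differentiable (smooth_chart_mul lieG Aa Aa Aa) WF.
have dF := differentiable_chart_conj Oy.
have did : differentiable (id : V -> V) y by [].
have dp : differentiable (fun z => (chart_conj z, z)) y := differentiable_pair dF did.
have e1 := derive_comp w dp dm.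
have e2 : \forall z \near y, (m \o (fun z => (chart_conj z, z))) z = rtr h a a z.
  apply: filterS (open_nbhs_nbhs (conj oO Oy)) => z Oz.
  rewrite /chart_mul /rtr /= chart_conjE // cmapK; last exact: Oconj.
  by rewrite mulgVK.
have e3 := near_eq_derive w e2.
have e4 := derive_pair w dF did.
have e5 := congr1 (fun q => 'D_q m (chart_conj y, y)) e4.
have split_pair : ('D_w chart_conj y, 'D_w id y) = ('D_w chart_conj y, 0) + (0, w) :> V * V.
  exact: (congr2 pair (esym (addr0 _)) (etrans (derive_id _ _) (esym (add0r w)))).
have e6 := congr1 (fun q => 'D_q m (chart_conj y, y)) split_pair.
have e7 := linD (derive_linear dm) ('D_w chart_conj y, 0) (0, w).
have e8 : 'D_((0, w) : V * V) m (chart_conj y, y) = lfield u a (rtr h a a y).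
  have gy : ltrdom (cinv a (chart_conj y)) a a y.
    by split; [exact: ay|rewrite /preimage /= cF mulgVK; exact: mh].
  have f1 := lfield_related lieG Aa a1 u Aa Aa gy.
  have f2 : ltr (cinv a (chart_conj y)) a a y = rtr h a a y by rewrite /ltr /rtr cF mulgVK.
  have f3 := congr1 (fun q => 'D_q (ltr (cinv a (chart_conj y)) a a) y) wE.
  have f4 := derive_slice_r m w (chart_conj y) y.
  exact: (etrans (esym f4) (etrans (esym f3) (etrans (esym f1) (congr1 (lfield u a) f2)))).
have e9 : 'D_w (rtr h a a) y = lfield u a (rtr h a a y).
  have f1 := rfield_related u (rtrO Oy).
  have f2 := rfield_lfield Br u Bh.
  have f3 := etrans (rfield_lfield Br u (OB Oy)) wE.
  have f4 := congr1 (fun q => 'D_q (rtr h a a) y) f3.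
  exact: (etrans (esym f4) (etrans (esym f1) f2)).
have e10 := etrans (esym e9) (etrans (esym e3) (etrans e1 (etrans e5 (etrans e6 e7)))).
have e11 : 'D_(('D_w chart_conj y, 0) : V * V) m (chart_conj y, y) = 0.
  have alg (p q s : V) : p = q + s -> s = p -> q = 0.
    by move=> -> /eqP; rewrite -subr_eq0 opprD addrCA subrr addr0 oppr_eq0 => /eqP.
  exact: (alg _ _ _ e10 e8).
have ry : rtrdom (cinv a y) a a (chart_conj y).
  by split; [exact: aF|rewrite /preimage /= cF mulgVK; exact: mh].
apply: (derive_rtr_inj ry).
exact: (etrans (derive_slice_l m ('D_w chart_conj y) (chart_conj y) y) e11).
Qed.

End Conjugation.

(** Near 1 the map y |-> y h y^-1 has zero derivative, so it keeps its value h
    at y = 1. *)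
Lemma commute_near1 : exists2 N : set G, nbhs (1%g : G) N &
  forall g h, N g -> N h -> (g * h = h * g)%g.
Proof.
have /nbhs_ballP [r /= r0 Br] : nbhs x0 (cimg a).
  by apply: open_nbhs_nbhs; split; [exact: open_cimg|].
pose S s : set G := cdom a `&` cmap a @^-1` ball x0 s.
have nS s : 0 < s -> nbhs (1%g : G) (S s).
  move=> s0; apply: filterI; first by apply: open_nbhs_nbhs; split=> //; exact: cdom_open.
  by apply: (cmap_cont a1); exact: nbhsx_ballx.
have conj_cont : continuous (fun p : G * G => (p.1 * p.2 * p.1^-1)%g).
  move=> p; apply: (@continuous_comp _ _ _ (fun p : G * G => ((p.1 * p.2)%g, (p.1^-1)%g))
    (fun p : G * G => (p.1 * p.2)%g)); last exact: mulG_cont.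
  apply: cvg_pair; first exact: mulG_cont.
  by apply: (@continuous_comp _ _ _ fst (fun g : G => g^-1%g)); [exact: cvg_fst|exact: invG_cont].
pose e : G := 1%g.
have n1 : nbhs (e, e) ((fun p : G * G => (p.1 * p.2)%g) @^-1` S r).
  exact: (nbhs_preimage (@mulG_cont (e, e)) (mulg1 e) (nS r r0)).
have n2 : nbhs (e, e) ((fun p : G * G => (p.1 * p.2 * p.1^-1)%g) @^-1` S r).
  have E : (e * e * e^-1)%g = e by rewrite mulgK.
  exact: (nbhs_preimage (@conj_cont (e, e)) E (nS r r0)).
have n3 : nbhs e ((fun g : G => g^-1%g) @^-1` S r).
  exact: (nbhs_preimage (@invG_cont e) (@invg1 G) (nS r r0)).
(* N0 is small enough that products, conjugates and inverses of its elements
   stay in the ball where left- and right-invariant fields agree. *)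
have [[P Q] /= [P1 Q1] PQ] := filterI n1 n2.
pose N0 := P `&` Q `&` (fun g => S r g^-1%g).
have nN0 : nbhs e N0 by apply: filterI => //; exact: filterI.
have /nbhs_ballP [s /= s0 Bs] : nbhs x0 (ball x0 r `&` cinv a @^-1` N0).
  apply: filterI; first exact: nbhsx_ballx.
  by apply: (cinv_cont ax0); rewrite cinv0.
exists (S s `&` N0); first by apply: filterI => //; exact: nS.
move=> g h [[ag sg] Ng] [_ [[_ Qh] _]].
have oB : open (ball x0 s) by exact: ball_open.
have OB : ball x0 s `<=` ball x0 r by move=> y /Bs [].
have Oinv y : ball x0 s y -> cdom a (cinv a y)^-1%g by move=> /Bs [_ [_ []]].
have OPQ y : ball x0 s y -> S r (cinv a y * h)%g /\ S r (cinv a y * h * (cinv a y)^-1)%g.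
  by move=> /Bs [_ [[Py _] _]]; exact: (PQ (_, h)).
have Omul y : ball x0 s y -> cdom a (cinv a y * h)%g /\ ball x0 r (cmap a (cinv a y * h)%g).
  by move=> /OPQ [[]].
have Oconj y : ball x0 s y -> cdom a (cinv a y * h * (cinv a y)^-1)%g.
  by move=> /OPQ [_ []].
have C := @derive0_constant R n n (chart_conj h) x0 s (fun y By =>
  conj (differentiable_chart_conj Br OB Oinv Omul Oconj By)
       (fun w => derive_chart_conj Br oB OB Oinv Omul Oconj w By)) (cmap a g) sg.
have E y : ball x0 s y -> cinv a (chart_conj h y) = (cinv a y * h * (cinv a y)^-1)%g.
  move=> By; rewrite /chart_conj /chart_mul /rtr /chart_inv /= [cinv a (cmap a (_ * h)%g)]cmapK.
    by rewrite [cinv a (cmap a (cinv a y)^-1)%g]cmapK ?cmapK //; [exact: Oconj|exact: Oinv].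
  by have [] := Omul y By.
have bx : ball x0 s x0 by exact: ballxx.
have := etrans (esym (E _ sg)) (etrans (congr1 (cinv a) C) (E _ bx)).
rewrite cinv0 mul1g invg1 mulg1 cmapK // => /(congr1 (fun k => k * g)%g).
by rewrite mulgVK.
Qed.

(** An open subgroup is closed, its complement being a union of cosets. *)
Lemma open_subgroup_full (S : set G) : connected [set: G] -> nbhs (1%g : G) S ->
  (forall x y, S x -> S y -> S (x * y)%g) -> (forall x, S x -> S x^-1%g) ->
  forall g, S g.
Proof.
move=> cG nS SM SV.
have nearS g : nbhs g (fun h => S (g^-1 * h)%g).
  by apply: (lmul_cont lieG); rewrite mulVg.
suff -> : S = setT by [].
apply: cG; first by exists 1%g; exact: nbhs_singleton.
- exists S; last by rewrite setTI.
  rewrite openE => g Sg; apply: filterS (nearS g) => h Sh.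
  by rewrite -[h](mulVKg g); exact: SM.
- exists S; last by rewrite setTI.
  rewrite -[S]setCK closedC openE => g Sg; apply: filterS (nearS g) => h Sgh Sh.
  apply: Sg; have -> : g = (h * (g^-1 * h)^-1)%g by rewrite invgM invgK mulVKg.
  exact: (SM _ _ Sh (SV _ Sgh)).
Qed.

(** The centralizer of an element close to 1 contains a neighbourhood of 1,
    so it is G; then the center contains a neighbourhood of 1. *)
Lemma connected_commutative : connected [set: G] -> forall g h : G, (g * h = h * g)%g.
Proof.
move=> cG; have [N N1 NC] := commute_near1.
pose C h : set G := [set g | (g * h = h * g)%g].
have CM h x y : C h x -> C h y -> C h (x * y)%g.
  by rewrite /C /= => xh yh; rewrite -mulgA yh mulgA xh mulgA.
have CV h x : C h x -> C h x^-1%g.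
  by rewrite /C /= => xh; rewrite -[h in LHS](mulgK x) -xh !mulgA mulVg mul1g.
have CN h g : N h -> C h g.
  move=> Nh; apply: (open_subgroup_full cG) => //; last exact: CV.
  - by apply: filterS N1 => x Nx; exact: NC.
  - exact: CM.
move=> g h; suff : C g h by [].
apply: (open_subgroup_full cG); [|exact: CM|exact: CV].
by apply: filterS N1 => x Nx; symmetry; exact: CN.
Qed.

End Abelian.

Theorem theorem7p4 (R : realType) :
  (forall (n : nat) (N : nilmanifold R n),
     two_step N -> ~ admits_left_invariant_gk N) /\
  (forall N : nilmanifold R 6, ~ is_torus N -> ~ admits_left_invariant_gk N).
Proof.
have abelian_algebra n (N : nilmanifold R n) : admits_left_invariant_gk N ->
    exists a, [/\ nil_gatlas N a, cdom a 1%g & forall u v, brk a u v = 0].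
  move=> [J1 [J2 [_ [K1 [K2 [gk [l1 l2] _ _]]]]]].
  have [k nil_k] := nil_nilpotent N.
  have [a Aa a1] := atlas_chart (nil_lie N) 1%g.
  by exists a; split=> //; exact: (gk_brk_trivial (nil_lie N) Aa a1 nil_k gk l1 l2).
split=> [n N [nontrivial _]|N not_torus] /abelian_algebra[a [Aa a1 br0]].
  by apply: nontrivial; exact: (lcs_trivial1 (nil_lie N) Aa a1 br0).
apply: not_torus.
by apply: (connected_commutative (nil_lie N) Aa a1 br0); have [] := nil_simply_connected N.
Qed.
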